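(* Let $r\ge 1$ and $q\ge r+1$ be integer constants. Then $$\lim_{g\to\infty}\ \sup_{G\in\mathcal{G}_0(n,g,r)}\left|\frac{\log Z(q,G)}{n}-\frac1n\sum_{1\le k\le n}\log\Big[q\Big(1-\frac1q\Big)^{r(v_k,G_{k-1})}\Big]\right|=0,$$ where the supremum is over all $n\ge 1$ and all $G\in\mathcal{G}_0(n,g,r)$. In particular, for every family $\mathcal{G}$ of graphs with maximum degree $r$ and large girth, there is a Polynomial Approximation Scheme (PAS) for computing $\log Z(q,G)$: for every $\epsilon>0$ there is a deterministic algorithm which for every $G\in\mathcal{G}$ with $n$ nodes produces an $\epsilon$-approximation of $\log Z(q,G)$ in time polynomial in $n$.
   Context: Graphs are finite and simple, with node set $V=\{v_1,\dots,v_n\}$ (the nodes are given in an arbitrary fixed order). $Z(q,G)$ is the number of proper $q$-colorings of $G$, i.e. of maps $V\to\{1,\dots,q\}$ giving different values to adjacent nodes. The girth $g(G)$ is the length of a shortest cycle ($\infty$ if there is none). $\mathcal{G}_0(n,g,r)$ is the set of all graphs with $n$ nodes, maximum degree $r$ and girth at least $g$. $G_0=G$ and $G_k=G\setminus\{v_1,\dots,v_k\}$ is the graph obtained by deleting the nodes $v_1,\dots,v_k$. $r(v,H)$ is the degree of the node $v$ in the graph $H$. An (infinite) family $\mathcal{G}$ of graphs has large girth if there is an increasing function $f:\mathbb{N}\to\mathbb{N}$ with $\lim_{s\to\infty}f(s)=\infty$ such that $g(G)\ge f(n)$ for every $G\in\mathcal{G}$ with $n$ nodes. A value $\alpha>0$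 is an $\epsilon$-approximation of $\log Z(q,G)$ if $(1-\epsilon)\frac{\log Z(q,G)}{n}\le\alpha\le(1+\epsilon)\frac{\log Z(q,G)}{n}$. A PAS is an algorithm producing, for every $\epsilon>0$, such an approximation in time polynomial in $n$, with arbitrary dependence on $\epsilon$ and on the family. *)

(* Defs.v *)
From mathcomp Require Import all_boot all_order all_algebra.
From mathcomp Require Import all_classical all_reals all_analysis.

Set Implicit Arguments.
Unset Strict Implicit.
Unset Printing Implicit Defensive.

Import Order.TTheory GRing.Theory Num.Theory.
Import numFieldNormedType.Exports.

Local Open Scope classical_set_scope.
Local Open Scope ring_scope.

(* The node v_k is the ordinal of value k - 1.  The fixed order of the nodes  *)
(* is that of 'I_n; it is arbitrary because the labelled graph is.            *)
Record sgraph (n : nat) := SGraph {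
  adj :> rel 'I_n;
  adj_sym : symmetric adj;
  adj_irr : irreflexive adj }.

Definition deg_in n (G : sgraph n) (A : pred 'I_n) (v : 'I_n) : nat :=
  #|[pred u | A u & G v u]|.

Definition maxdeg n (G : sgraph n) : nat := (\max_(v < n) deg_in G predT v)%N.

(* Node set of G_k. *)
Definition after_deletion n (k : nat) : pred 'I_n := fun u => (k <= u)%N.

(* [ucycleb] alone also accepts [::] and [:: u; v] with u, v adjacent. *)
Definition is_cycle n (G : sgraph n) (c : seq 'I_n) : bool :=
  (2 < size c)%N && ucycleb G c.

Definition girth (R : realType) n (G : sgraph n) : \bar R :=
  ereal_inf [set (size c)%:R%:E | c in [set c | is_cycle G c]].

Definition proper n (G : sgraph n) (q : nat) (c : {ffun 'I_n -> 'I_q}) : bool :=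
  [forall u, forall v, G u v ==> (c u != c v)].

Definition Z (q : nat) n (G : sgraph n) : nat :=
  #|[pred c : {ffun 'I_n -> 'I_q} | proper G c]|.

(* "Maximum degree r" is read as "all degrees are at most r"; the result for   *)
(* these graphs contains the one for graphs with maximum degree exactly r.    *)
Definition graphs_G0 (R : realType) (n g r : nat) : set (sgraph n) :=
  [set G | (maxdeg G <= r)%N /\ (g%:R%:E <= girth R G)%E].
Arguments graphs_G0 R n g r : clear implicits.

Definition log_density (R : realType) (q n : nat) (G : sgraph n) : R :=
  ln (Z q G)%:R / n%:R.

(* The summand of index k : 'I_n involves v_(k+1) and G_k. *)
Definition sum_density (R : realType) (q n : nat) (G : sgraph n) : R :=
  n%:R^-1 * \sum_(k < n)
    ln (q%:R * (1 - q%:R^-1) ^+ deg_in G (after_deletion k) k).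

(* A family of graphs is a set of graphs for each number of nodes. *)
Definition large_girth (R : realType) (F : forall n, set (sgraph n)) : Prop :=
  exists f : nat -> nat,
    [/\ {homo f : s t / (s <= t)%N},
        f s @[s --> \oo] --> \oo
      & forall n (G : sgraph n), F n G -> ((f n)%:R%:E <= girth R G)%E].

Definition eps_approx (R : realType) (q n : nat) (G : sgraph n) (eps a : R) :
    Prop :=
  [/\ 0 < a,
      (1 - eps) * log_density R q G <= a
    & a <= (1 + eps) * log_density R q G].

(* Algorithms are programs for a random access machine with indirect          *)
(* addressing whose only arithmetic is addition and truncated subtraction.    *)
(* Each executed instruction or test costs one step.  In the absence of       *)
(* multiplication and shifts the bit length of the numbers grows by at most   *)
(* one per step, so polynomial time is the same as on Turing machines.        *)
Inductive instr : Type :=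
| IConst of nat & nat                     (* IConst x a : x := a *)
| IAdd of nat & nat & nat                 (* IAdd x y z : x := y + z *)
| ISub of nat & nat & nat                 (* ISub x y z : x := y - z *)
| ILoad of nat & nat                      (* ILoad x y : x := mem[y] *)
| IStore of nat & nat                     (* IStore x y : mem[x] := y *)
| IIf of nat & seq instr & seq instr      (* branches on x != 0 *)
| IWhile of nat & seq instr.              (* repeats while x != 0 *)

Record store := Store_ { reg : nat -> nat; mem : nat -> nat }.

Definition upd (f : nat -> nat) (x a : nat) : nat -> nat :=
  fun y => if y == x then a else f y.

Definition set_reg (s : store) (x a : nat) : store :=
  Store_ (upd (reg s) x a) (mem s).

(* The first component is what remains to be executed. *)
Definition step (cf : seq instr * store) : seq instr * store :=
  let: (p, s) := cf in
  match p with
  | [::] => ([::], s)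
  | IConst x a :: p' => (p', set_reg s x a)
  | IAdd x y z :: p' => (p', set_reg s x (reg s y + reg s z)%N)
  | ISub x y z :: p' => (p', set_reg s x (reg s y - reg s z)%N)
  | ILoad x y :: p' => (p', set_reg s x (mem s (reg s y)))
  | IStore x y :: p' => (p', Store_ (reg s) (upd (mem s) (reg s x) (reg s y)))
  | IIf x p1 p2 :: p' => ((if reg s x != 0%N then p1 else p2) ++ p', s)
  | IWhile x p1 :: p' => (if reg s x != 0%N then p1 ++ p else p', s)
  end.

(* [s'] is reached within [t] steps from [s], and nothing is left to do. *)
Definition halts_within (t : nat) (p : seq instr) (s s' : store) : Prop :=
  iter t step (p, s) = ([::], s').

(* The input is n in register 0 and the adjacency matrix, row by row, in      *)
(* memory; everything else is 0.                                              *)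
Definition input n (G : sgraph n) : store :=
  Store_ (fun x => if x == 0%N then n else 0%N)
    (fun a => [exists u : 'I_n, exists v : 'I_n,
                 (a == u * n + v)%N && G u v] : nat).

(* The output is a rational number: numerator in register 0, denominator in   *)
(* register 1.                                                                *)
Definition output (R : realType) (s : store) : R :=
  (reg s 0)%:R / (reg s 1)%:R.

(* The program and the time bound depend on q, F and eps only. *)
Definition has_PAS (R : realType) (q : nat) (F : forall n, set (sgraph n)) :
    Prop :=
  forall eps : R, 0 < eps ->
  exists (p : seq instr) (c d : nat),
  forall n (G : sgraph n), (0 < n)%N -> F n G ->
  exists s : store,
    halts_within (c * n ^ d + c)%N p (input G) s /\
    eps_approx q G eps (output R s).

(* Main.v *)
Require Import Defs.
From mathcomp Require Import all_boot all_order all_algebra.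
From mathcomp Require Import all_classical all_reals all_analysis.
From mathcomp Require Import perm zify lra.

Import Order.TTheory GRing.Theory Num.Theory.
Import numFieldNormedType.Exports.

Local Open Scope classical_set_scope.
Local Open Scope ring_scope.

(** The chromatic sum factors as a telescoping product over deletions of nodes: the
number of colourings of G_k divided by that of G_(k+1) is the sum, over the
colours c, of the probability that a random colouring of G_(k+1) gives colour c
to no neighbour of the deleted node.  If the neighbours were independent and
uniform this probability would be (1 - 1/q)^d, with d the degree of the node in
G_k, and the sum of logarithms is exactly what the statement compares with
log Z.  In a graph of large girth the neighbours lie, after the deletion, in
different branches of a tree of large depth, so conditionally on the colours
outside a ball they are exactly independent
([card_avoid_seq], [ball_acyclic]); it remains to see that each is close to
uniform whatever the boundary condition is.  This is uniqueness of the Gibbs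
measure for q-colourings of trees of degree at most q - 1, in the form
[marg_near_uniform], and it is the heart of the proof.

Uniqueness is proved with a Lyapunov function.  Marginals on a tree obey the
recursion p'(c) = prod_i (1 - p_i(c)) / normaliser over at most q - 2 children.
Let m = q - 1 and write q p'(c) = 1 + s_c, q p_i(c) = 1 + t_ic.  As the s_c have
sum zero, the normaliser disappears from the identity
  sum_c s_c ln (1 + s_c) = sum_i sum_c s_c ln (1 - t_ic / m).
Let F(p) = sum_c (sqrt (q p(c)) - 1)^2 be the squared Hellinger distance to the
uniform distribution, up to a constant.  The logarithm on the left is bounded
below by
  s ln (1 + s) >= 2 (sqrt (1 + s) - 1)^2 + s^2 / (2 + s),
and the products on the right by the Young-type inequality
  s^2 / (2 + s) + s b >= - 2 (sqrt (1 + b) - 1)^2,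
where b = - (m - 1) ln (1 - t / m).  Hence F(p') is at most the largest value of
sum_c (sqrt (1 + b_ic) - 1)^2 over the children i.  If the p_i are bounded so that
b is at most a constant l < 1 times t, this gives F(p') <= l max F(p_i)
([hellinger_bp_le]).  The bound needed on the p_i, about 3/q, holds after a few
levels of the recursion: next to the boundary marginals are at most 1/2, and each
further level improves the bound through the convexity of exp ([bp_le]).

For the approximation scheme, the sum in the statement depends only on the
number of edges, and it is bounded away from zero.  Graphs with many nodes have
large girth, so a machine program need only count the ones of the adjacency
matrix and evaluate a linear expression with rational approximations of ln q and
ln (1 - 1/q).  The finitely many sizes that remain are treated by a decision
tree on the entries of the matrix. *)

(** * Rational bounds on logarithms *)

Lemma derive_ge0_homo (R : realType) (f df : R -> R) :
  (forall x : R, 0 < x -> is_derive x 1 f (df x)) ->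
  (forall x : R, 0 < x -> 0 <= df x) ->
  forall a b : R, 0 < a -> a <= b -> f a <= f b.
Proof.
move=> fd df0 a b a0 ab.
have gt0 (x : R) : a <= x -> 0 < x by exact: lt_le_trans.
have [|x|c /itvP cab D] := @MVT_segment R f df a b ab.
- by move=> x /itvP xab; apply: fd; apply: gt0; rewrite xab.
- apply: derivable_within_continuous => y /itvP yab.
  by case: (fd y (gt0 _ _)) => //; rewrite yab.
by rewrite -subr_ge0 D mulr_ge0 ?subr_ge0// df0// gt0// cab.
Qed.

(** The derivative of the difference is (x - 1)^2 / (x (x + 1)^2).  Both signs of
the Pade bound on ln follow, as the difference vanishes at 1. *)
Lemma ln_sub_pade_homo (R : realType) (a b : R) : 0 < a -> a <= b ->
  ln a - 2 * ((a - 1) / (a + 1)) <= ln b - 2 * ((b - 1) / (b + 1)).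
Proof.
pose f := fun x : R => ln x + (4 * (x + 1)^-1).
have fE x : 0 < x -> ln x - 2 * ((x - 1) / (x + 1)) = f x - 2.
  move=> x0; rewrite /f; have x1 : x + 1 != 0 by rewrite gt_eqF// addr_gt0.
  have := divff x1; lra.
move=> a0 ab; rewrite !fE ?(lt_le_trans a0)// lerD2r.
apply: (@derive_ge0_homo R f (fun x => x^-1 - 4 * (x + 1) ^- 2)) => // x x0.
  have x1 : x + 1 != 0 by rewrite gt_eqF// addr_gt0.
  have dln := is_derive1_ln x0.
  apply: is_derive_eq.
  by rewrite /GRing.scale /=; lra.
have x1 : x + 1 != 0 by rewrite gt_eqF// addr_gt0.
have -> : x^-1 - 4 * (x + 1) ^- 2 = (x - 1) ^+ 2 * (x^-1 * (x + 1) ^- 2).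
  have h1 : (x + 1) ^+ 2 / (x + 1) ^+ 2 = 1 by rewrite divff ?sqrf_eq0.
  have h2 : x / x = 1 by rewrite divff// gt_eqF.
  have := congr1 (fun t => t * x^-1) h1.
  have := congr1 (fun t => 4 * t * (x + 1) ^- 2) h2.
  lra.
by rewrite mulr_ge0 ?sqr_ge0// mulr_ge0 ?invr_ge0 ?sqr_ge0// ltW.
Qed.

Lemma ln_ge_pade (R : realType) (x : R) : 1 <= x ->
  2 * ((x - 1) / (x + 1)) <= ln x.
Proof.
by move=> x1; have := @ln_sub_pade_homo R _ _ ltr01 x1; rewrite ln1; lra.
Qed.

Lemma ln_le_pade (R : realType) (x : R) : 0 < x -> x <= 1 ->
  ln x <= 2 * ((x - 1) / (x + 1)).
Proof.
by move=> x0 x1; have := @ln_sub_pade_homo R _ _ x0 x1; rewrite ln1; lra.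
Qed.

Lemma ln_le_half_sub_inv (R : realType) (x : R) : 1 <= x ->
  ln x <= (x - x^-1) / 2.
Proof.
pose f := fun x : R => 2^-1 * (x - x^-1) - ln x.
move=> x1.
suff : f 1 <= f x by rewrite /f ln1 invr1; lra.
have f_derive (y : R) : 0 < y ->
    is_derive y 1 f (2^-1 * (1 + y ^- 2) - y^-1).
  move=> y0; have yn0 : y != 0 by rewrite gt_eqF.
  have dln := is_derive1_ln y0.
  have dV : is_derive y 1 (fun z : R => z^-1) (- y ^- 2 *: 1).
    exact: (@is_deriveV _ id).
  have -> : 2^-1 * (1 + y ^- 2) - y^-1
      = 2^-1 *: (1 - - y ^- 2 *: 1) - y^-1 :> R by rewrite /GRing.scale /=; lra.
  by apply: is_deriveB; apply: is_deriveZ; apply: is_deriveB.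
apply: (@derive_ge0_homo R f _ f_derive _ 1 x ltr01 x1) => y y0.
have -> : 2^-1 * (1 + y ^- 2) - y^-1 = (1 - y^-1) ^+ 2 / 2.
  by rewrite -exprVn; lra.
by rewrite divr_ge0 ?sqr_ge0.
Qed.

Lemma oppr_ln_1sub_le (R : realType) (z : R) : 0 <= z -> z < 1 ->
  - ln (1 - z) <= z * ((2 - z) / (2 * (1 - z))).
Proof.
move=> z0 z1; have h : 0 < 1 - z by lra.
rewrite -lnV ?posrE// (le_trans (@ln_le_half_sub_inv R _ _))//.
  by rewrite invf_ge1//; lra.
rewrite invrK invfM.
have h1 : (1 - z) / (1 - z) = 1 by rewrite divff// gt_eqF.
have := congr1 (fun t => (1 - z) * t) h1; lra.
Qed.

Lemma ln_ge_of_pade (R : realType) (x c : R) :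
  1 <= x -> c * (x + 1) <= 2 * (x - 1) -> c <= ln x.
Proof.
move=> x1 hc; apply: le_trans (ln_ge_pade _ _ x1).
by rewrite mulrA ler_pdivlMr//; lra.
Qed.

(** The factors 4/3 and 3/2 are close enough to 1 for the Pade bound to be sharp;
the two lemmas that follow split their constants in the same way. *)
Lemma ln2_ge (R : realType) : 24 / 35 <= ln (2 : R).
Proof.
have -> : (2 : R) = (4 / 3) * (3 / 2) by lra.
rewrite lnM ?posrE; try lra.
have : 2 / 7 <= ln (4 / 3 : R) by apply: ln_ge_of_pade; lra.
have : 2 / 5 <= ln (3 / 2 : R) by apply: ln_ge_of_pade; lra.
lra.
Qed.

Lemma expR1_le (R : realType) : expR 1 <= 11 / 4 :> R.
Proof.
have h : 0 < 11 / 4 :> R by lra.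
have <- : expR (ln (11 / 4 : R)) = 11 / 4 by rewrite lnK ?posrE.
rewrite ler_expR.
have -> : (11 / 4 : R) = (11 / 8) * 2 by lra.
rewrite lnM ?posrE; try lra.
have : 6 / 19 <= ln (11 / 8 : R) by apply: ln_ge_of_pade; lra.
have := ln2_ge R; lra.
Qed.

Lemma expR3half_le (R : realType) : expR (3 / 2) <= 5 :> R.
Proof.
have h : 0 < 5 :> R by lra.
have <- : expR (ln (5 : R)) = 5 by rewrite lnK ?posrE.
rewrite ler_expR.
have -> : (5 : R) = (5 / 4) * (2 * 2) by lra.
rewrite (@lnM R (5 / 4)) ?(@lnM R 2 2) ?posrE; try lra.
have : 2 / 9 <= ln (5 / 4 : R) by apply: ln_ge_of_pade; lra.
have := ln2_ge R; lra.
Qed.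

(** * The tree recursion contracts the Hellinger distance to uniformity *)

(** Here M = q - 1, x is a marginal at a child and b a bound for such marginals.
The quantity t is the relative deviation of x from 1 / (M + 1), and - a is the
logarithm of the relative weight that M - 1 children with this marginal produce
at the parent.  For t < 0 concavity of ln suffices.  For t > 0 the ratio a / t increases
with t, and l bounds it at the largest t that b allows. *)
Lemma log_potential_bound (R : realType) (M b x : R) :
    1 <= M -> 1 <= (M + 1) * b -> b < 1 -> 0 <= x -> x <= b ->
    let l := (M - 1) / M * (1 / 2 + M / (2 * ((M + 1) * (1 - b)))) in
    let t := (M + 1) * x - 1 in
    let a := - ((M - 1) * ln ((1 - x) * ((M + 1) / M))) in
  (0 <= a <= l * t) \/ (l * t <= a <= 0).
Proof.
move=> M1 b0 b1 x0 xb l t a.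
have M0 : 0 < M by lra.
have MM : M / M = 1 by rewrite divff// gt_eqF.
pose z := t / M.
have zM : z * M = t by rewrite divfK// gt_eqF.
have hb : 0 < (M + 1) * (1 - b) by rewrite mulr_gt0//; lra.
pose y := M / (2 * ((M + 1) * (1 - b))).
have yE : y * (2 * ((M + 1) * (1 - b))) = M by rewrite divfK// gt_eqF//; lra.
have y_ge : 1 / 2 <= y by rewrite ler_pdivlMr; lra.
pose w := (M - 1) / M.
have wM : w * M = M - 1 by rewrite divfK// gt_eqF.
have w0 : 0 <= w by rewrite divr_ge0//; lra.
have lE : l = w * (1 / 2 + y) by [].
have lw : w <= l by rewrite lE; nra.
have factorE : (1 - x) * ((M + 1) / M) = 1 - z by rewrite /z /t; lra.
have z1 : 0 < 1 - z by rewrite -factorE mulr_gt0 ?divr_gt0//; lra.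
rewrite /a factorE; clear a; clearbody l.
have [t0|t0] := leP 0 t; [left|right].
  have z0 : 0 <= z by rewrite divr_ge0 // ltW.
  have hln : ln (1 - z) <= 0 by apply: ln_le0; lra.
  apply/andP; split; first nra.
  have z1' : z < 1 by lra.
  have := oppr_ln_1sub_le _ _ z0 z1' => h.
  rewrite -mulrN; apply: (@le_trans _ _ ((M - 1) * (z * ((2 - z) / (2 * (1 - z)))))).
    by rewrite ler_wpM2l//; lra.
  have -> : l * t = (M - 1) * (z * (1 / 2 + y)) by rewrite lE -zM -wM; lra.
  apply: ler_wpM2l; first lra.
  apply: ler_wpM2l => //.
  have -> : (2 - z) / (2 * (1 - z)) = 1 / 2 + (2 * (1 - z))^-1.
    have : 2 * (1 - z) / (2 * (1 - z)) = 1 by rewrite divff// gt_eqF//; lra.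
    lra.
  rewrite lerD2l -[_^-1]mul1r ler_pdivrMr; last lra.
  have : (M + 1) * (1 - b) <= M * (1 - z).
    have : (M + 1) * x <= (M + 1) * b by apply: ler_wpM2l; lra.
    have := zM; rewrite /t; lra.
  have y0 : 0 < y by lra.
  rewrite -(ler_pM2l y0) => h2.
  have : M * 1 <= M * (y * (2 * (1 - z))) by lra.
  by rewrite ler_pM2l.
have z0 : z < 0 by rewrite ltr_pdivrMr ?mul0r.
have hln : 0 <= ln (1 - z) by apply: ln_ge0; lra.
apply/andP; split; last nra.
have hln2 : ln (1 - z) <= - z by apply: le_ln1Dx; lra.
apply: (@le_trans _ _ (w * t)); first by rewrite ler_wnM2r// ltW.
have -> : w * t = - ((M - 1) * - z) by rewrite -zM -wM; lra.
by rewrite lerN2 ler_wpM2l//; lra.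
Qed.

Section Constants.
Variables (R : realType) (m : nat).

(** Bound on marginals two levels above the boundary.  The value 11 / (4 m + 5)
exceeds 1/2 for small m, where the trivial bound 1/2 already suffices. *)
Definition marg_cap : R := if (m <= 4)%N then 1 / 2 else 11 / (4 * m%:R + 5).

(** The factor l of [log_potential_bound] for M = m and b = [marg_cap]. *)
Definition contraction_rate : R :=
  (m%:R - 1) / m%:R * (1 / 2 + m%:R / (2 * ((m%:R + 1) * (1 - marg_cap)))).

Lemma marg_cap_bounds : (0 < m)%N ->
  [/\ 1 <= m.+1%:R * marg_cap, marg_cap < 1 & m.+1%:R ^+ 2 * marg_cap < 3 * m%:R + 1].
Proof.
move=> m0; rewrite /marg_cap -natr1.
case: leqP => m4.
  have : (m == 1 \/ m == 2 \/ m == 3 \/ m == 4)%N by lia.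
  by case=> [/eqP->|[/eqP->|[/eqP->|/eqP->]]]; split; lra.
have m5 : 5 <= m%:R :> R by rewrite (ler_nat R 5 m).
set M := m%:R in m5 *.
have h : 0 < 4 * M + 5 by lra.
split.
- by rewrite mulrA ler_pdivlMr//; lra.
- by rewrite ltr_pdivrMr//; lra.
- by rewrite mulrA ltr_pdivrMr//; nra.
Qed.

(** The rate is below 1 exactly when (m + 1)^2 b < 3 m + 1. *)
Lemma contraction_rate_bounds : (0 < m)%N -> 0 <= contraction_rate < 1.
Proof.
move=> m0; have [_ h1 h2] := marg_cap_bounds m0.
have m1 : 1 <= m%:R :> R by rewrite ler1n.
move: h1 h2; rewrite /contraction_rate -natr1; set M := m%:R in m1 *.
set p := marg_cap => h1 h2.
have hp : 0 < 1 - p by lra.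
have hM : 0 < (M + 1) * (1 - p) by apply: mulr_gt0; lra.
have hM2 : 0 < 2 * ((M + 1) * (1 - p)) by apply: mulr_gt0.
apply/andP; split.
  rewrite mulr_ge0// ?divr_ge0//; try lra.
  by rewrite addr_ge0// divr_ge0//; lra.
set y := M / (2 * ((M + 1) * (1 - p))).
have hy : y * (2 * ((M + 1) * (1 - p))) = M by rewrite divfK// gt_eqF.
rewrite mulrAC ltr_pdivrMr ?mul1r; last lra.
have : (M - 1) * M < (M + 1) ^+ 2 * (1 - p) by nra.
rewrite -hy => h3.
have : (M - 1) * (2 * y) < M + 1.
  rewrite -(ltr_pM2r hM); nra.
nra.
Qed.

(** With w^2 = 1 + l t, concavity of the square root gives
w >= 1 - l + l sqrt (1 + t), which turns (w - 1)^2 <= l (sqrt (1 + t) - 1)^2 into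
an identity up to a nonnegative term; sqrt (1 + a) lies between 1 and w. *)
Lemma sqr_sqrt_sub1_le (l t a : R) : 0 <= l <= 1 -> -1 <= t ->
    (0 <= a <= l * t) \/ (l * t <= a <= 0) ->
  (Num.sqrt (1 + a) - 1) ^+ 2 <= l * (Num.sqrt (1 + t) - 1) ^+ 2.
Proof.
move=> /andP[l0 l1] t1 ha.
have lt1 : -1 <= l * t by nra.
set u := Num.sqrt (1 + t); set v := Num.sqrt (1 + a).
pose w := Num.sqrt (1 + l * t).
have uE : u ^+ 2 = 1 + t by rewrite sqr_sqrtr//; lra.
have wE : w ^+ 2 = 1 + l * t by rewrite sqr_sqrtr//; lra.
have u0 : 0 <= u by exact: sqrtr_ge0.
have w0 : 0 <= w by exact: sqrtr_ge0.
have w_ge : 1 - l + l * u <= w.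
  rewrite -(@ler_pXn2r _ 2)// ?nnegrE; [rewrite wE|nra].
  have -> : t = u ^+ 2 - 1 by lra.
  have : 0 <= l * (1 - l) * (u - 1) ^+ 2.
    by rewrite mulr_ge0 ?sqr_ge0// mulr_ge0//; lra.
  nra.
apply: (@le_trans _ _ ((w - 1) ^+ 2)); last by nra.
have s1 : Num.sqrt 1 = 1 :> R by exact: sqrtr1.
case: ha => /andP[a0 a1].
  have : 1 <= v by rewrite -s1 /v ler_sqrt; lra.
  have : v <= w by rewrite /v /w ler_sqrt; lra.
  nra.
have : v <= 1 by rewrite -s1 /v ler_sqrt; lra.
have : w <= v by rewrite /v /w ler_sqrt; lra.
nra.
Qed.

(** Put u = sqrt x and split ln x = ln u + (ln x) / 2.  The Pade bounds on the two
halves give the two terms on the left, exactly. *)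
Lemma hellinger_entropy_le (x : R) : 0 < x ->
  2 * (Num.sqrt x - 1) ^+ 2 + (x - 1) ^+ 2 / (x + 1) <= (x - 1) * ln x.
Proof.
move=> x0; set u := Num.sqrt x.
have u0 : 0 < u by rewrite sqrtr_gt0.
have uE : x = u ^+ 2 by rewrite sqr_sqrtr// ltW.
have lnE : ln x = ln u *+ 2 by rewrite uE lnXn.
have hu : (u + 1) * ((u - 1) / (u + 1)) = u - 1.
  by rewrite mulrCA divff ?mulr1// gt_eqF// addr_gt0.
have hx : (x - 1) ^+ 2 / (x + 1) = (x - 1) * ((x - 1) / (x + 1)) by rewrite expr2 mulrA.
have hu2 : 2 * (u - 1) ^+ 2 = (x - 1) * (2 * ((u - 1) / (u + 1))).
  have := congr1 (fun t => 2 * (u - 1) * t) hu; rewrite uE; lra.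
rewrite hu2 hx.
have [x1|/ltW x1] := leP 1 x.
  have u1 : 1 <= u by rewrite -(sqrtr1 R) ler_sqrt// ltW.
  have hlu := ln_ge_pade _ _ u1; have hlx := ln_ge_pade _ _ x1.
  by rewrite -mulrDr; apply: ler_wpM2l; lra.
have u1 : u <= 1 by rewrite -[leRHS](sqrtr1 R) ler_sqrt.
have hlu := ln_le_pade _ _ u0 u1; have hlx := ln_le_pade _ _ x0 x1.
by rewrite -mulrDr; apply: ler_wnM2l; lra.
Qed.

(** Multiplied by x + 1 the difference of the two sides is the square
((x + 1) sqrt (1 + b) - 2)^2.  So the Hellinger term on the right is the Legendre
transform of (x - 1)^2 / (x + 1). *)
Lemma hellinger_dual (x b : R) : 0 < x -> 0 <= 1 + b ->
  - ((x - 1) * b) <= (x - 1) ^+ 2 / (x + 1) + 2 * (Num.sqrt (1 + b) - 1) ^+ 2.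
Proof.
move=> x0 b0; set v := Num.sqrt _.
have vE : b = v ^+ 2 - 1 by rewrite sqr_sqrtr//; lra.
have x1 : 0 < x + 1 by lra.
rewrite vE -subr_ge0.
set y := (x - 1) ^+ 2 / (x + 1).
have yE : y * (x + 1) = (x - 1) ^+ 2 by rewrite divfK// gt_eqF.
rewrite -(pmulr_lge0 _ x1).
have := sqr_ge0 ((x + 1) * v - 2).
nra.
Qed.

End Constants.

Section BeliefPropagation.
Variables (R : realType) (C : finType) (m : nat).
Hypothesis cardC : #|C| = m.+1.

Definition is_dist (p : C -> R) := (forall c, 0 <= p c) /\ \sum_c p c = 1.

(** Twice the squared Hellinger distance between p and the uniform distribution,
times the number of colours. *)
Definition hellinger (p : C -> R) : R :=
  \sum_c (Num.sqrt (m.+1%:R * p c) - 1) ^+ 2.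

Variables (I : finType) (P : pred I) (p : I -> C -> R).
Hypothesis cardP : (#|P| < m)%N.
Hypothesis distP : forall i, P i -> is_dist (p i).

(** One step of belief propagation: the marginal at the root of a tree whose
branches at the nodes i with P i have root marginals p i. *)
Definition bp (c : C) : R :=
  (\prod_(i | P i) (1 - p i c)) / \sum_b \prod_(i | P i) (1 - p i b).

Let X c := \prod_(i | P i) (1 - p i c).

Lemma m_gt0 : (0 < m)%N. Proof. exact: leq_ltn_trans cardP. Qed.

Lemma sum_log_le (M : R) : 0 <= M ->
    (forall i c, P i -> p i c <= M) -> M < 1 ->
  - \sum_b \sum_(i | P i) ln (1 - p i b)
     <= (m%:R - 1) * ((2 - M) / (2 * (1 - M))).
Proof.
move=> M0 pM M1; rewrite exchange_big/= -sumrN.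
set k := (2 - M) / _.
have k0 i b : P i -> - ln (1 - p i b) <= p i b * k.
  move=> Pi; have [p0 _] := distP _ Pi; have pb := p0 b; have pMb := pM _ b Pi.
  have hM : 0 < 1 - M by lra.
  apply: le_trans (oppr_ln_1sub_le _ _ pb _) _; first lra.
  rewrite ler_wpM2l// /k ler_pdivlMr; last lra.
  rewrite mulrAC ler_pdivrMr; nra.
have {}k0 i : P i -> - \sum_b ln (1 - p i b) <= k.
  move=> Pi; rewrite -sumrN.
  apply: (@le_trans _ _ (\sum_b p i b * k)).
    by apply: ler_sum => b _; exact: k0.
  by rewrite -mulr_suml; have [_ ->] := distP _ Pi; rewrite mul1r.
have kge0 : 0 <= k by rewrite divr_ge0//; lra.
apply: le_trans (ler_sum _ k0) _.
rewrite sumr_const -[_ *+ #|_|]mulr_natl ler_wpM2r// lerBrDr natr1 ler_nat; exact: cardP.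
Qed.

(** The numerator is at most 1.  The other weights are exponentials of numbers
y b whose sum is bounded below by [sum_log_le]; the tangent line of exp at the
mean value mu bounds their sum below by m exp mu. *)
Lemma bp_le (M K : R) : 0 <= M -> (forall i c, P i -> p i c <= M) -> M < 1 ->
    0 < K ->
    expR ((m%:R - 1) * ((2 - M) / (2 * (1 - M))) / m%:R) <= K ->
  forall c, bp c <= K / (m%:R + K).
Proof.
move=> M0 pM M1 K0 hK c; have m0 := m_gt0.
have mR0 : 0 < m%:R :> R by rewrite ltr0n.
set k := (m%:R - 1) * _ in hK.
have hX b : 0 < X b <= 1.
  apply/andP; split.
    by apply: prodr_gt0 => i Pi; have := pM i b Pi; lra.
  apply: prodr_ile1 => i Pi; have := pM i b Pi; have [p0 _] := distP _ Pi.
  by have := p0 b; lra.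
pose y b := \sum_(i | P i) ln (1 - p i b).
have yE b : X b = expR (y b).
  rewrite /y expR_sum; apply: eq_bigr => i Pi; rewrite lnK// posrE.
  by have := pM i b Pi; lra.
have y0 b : y b <= 0 by rewrite -ler_expR -yE expR0; case/andP: (hX b).
have hk : - \sum_b y b <= k by exact: sum_log_le.
(* The sum of the m numbers y b with b != c is at least m mu. *)
set mu := - k / m%:R.
have emu : m%:R <= K * (m%:R * expR mu).
  rewrite mulrCA -{1}[m%:R]mulr1 ler_pM2l// /mu mulNr expRN.
  rewrite ler_pdivlMr ?expR_gt0//.
  by rewrite mul1r.
set Y := \sum_(b | b != c) X b.
have hY : m%:R * expR mu <= Y.
  apply: (@le_trans _ _ (\sum_(b | b != c) expR mu * (1 + (y b - mu)))); last first.
    apply: ler_sum => b _; rewrite yE -{2}(subrK mu (y b)) expRD mulrC.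
    by rewrite ler_wpM2r ?expR_ge0// expR_ge1Dx.
  rewrite -mulr_sumr mulrC ler_wpM2l ?expR_ge0//.
  rewrite (_ : \sum_(b | b != c) _ = \sum_(b | b != c) (1 - mu) + \sum_(b | b != c) y b); last first.
    by rewrite -big_split/=; apply: eq_bigr => b _; lra.
  rewrite sumr_const.
  have -> : #|[pred b | b != c]| = m.
    by rewrite (eq_card (B := predC1 c)) ?cardC1 ?cardC.
  have hsum : \sum_b y b = y c + \sum_(b | b != c) y b by rewrite (bigD1 c).
  have hmu : mu * m%:R = - k by rewrite /mu divfK// gt_eqF.
  rewrite -[(1 - mu) *+ m]mulr_natr mulrBl hmu mul1r.
  have := y0 c; lra.
have XY : \sum_b X b = X c + Y by rewrite (bigD1 c).
have Y0 : 0 <= Y by apply: sumr_ge0 => b _; case/andP: (hX b) => /ltW.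
case/andP: (hX c) => Xc0 Xc1.
rewrite /bp -/(X c) -[\sum_b _]/(\sum_b X b) XY.
rewrite ler_pdivrMr; last by lra.
rewrite mulrAC ler_pdivlMr; last by lra.
have : m%:R <= K * Y by apply: le_trans emu _; rewrite ler_pM2l.
nra.
Qed.

Hypothesis p_le_cap : forall i c, P i -> p i c <= marg_cap R m.

(** The computation explained at the top.  Missing children (fewer than m - 1)
only help, because psi is nonnegative. *)
Lemma hellinger_bp_le (B : R) : 0 <= B ->
  (forall i, P i -> hellinger (p i) <= B) -> hellinger bp <= contraction_rate R m * B.
Proof.
move=> B0 hB; have m0 := m_gt0.
have mR1 : 1 <= m%:R :> R by rewrite ler1n.
have [pm0 pm1 _] := marg_cap_bounds R m m0.
have /andP[l0 l1] := contraction_rate_bounds R m m0.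
pose a i c := - ((m%:R - 1) * ln ((1 - p i c) * (m.+1%:R / m%:R))).
pose t i c := m.+1%:R * p i c - 1.
have mS : m.+1%:R = m%:R + 1 :> R by rewrite natr1.
have p_ge0 i c : P i -> 0 <= p i c by move=> Pi; have [h _] := distP _ Pi.
have t_ge i c : P i -> -1 <= t i c.
  move=> Pi; have h : 0 <= m.+1%:R * p i c by rewrite mulr_ge0 ?p_ge0.
  by rewrite /t; lra.
have factor_gt0 i c : P i -> 0 < 1 - p i c.
  by move=> Pi; have := p_le_cap _ c Pi; lra.
have a_bound i c : P i ->
    (0 <= a i c <= contraction_rate R m * t i c) \/ (contraction_rate R m * t i c <= a i c <= 0).
  move=> Pi; rewrite /a /t mS.
  by apply: log_potential_bound; rewrite -?mS ?p_ge0 ?p_le_cap.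
have a_ge i c : P i -> 0 <= 1 + a i c.
  move=> Pi; have ht := t_ge _ c Pi; case: (a_bound i c Pi) => /andP[h1 h2]; first lra.
  by nra.
have X0 c : 0 < X c by apply: prodr_gt0 => i Pi; exact: factor_gt0.
have C0 : C by have := cardC; case: (pickP (mem C)) => // h; rewrite eq_card0.
have N0 : 0 < \sum_b X b.
  by rewrite (bigD1 C0)//= ltr_wpDr// sumr_ge0// => b _; exact: ltW.
have bpE c : bp c = X c / \sum_b X b by [].
have bp0 c : 0 < bp c by rewrite bpE divr_gt0.
have bp1 : \sum_c bp c = 1.
  by rewrite -mulr_suml divff// gt_eqF.
pose s c := m.+1%:R * bp c - 1.
have s0 : \sum_c s c = 0.
  rewrite sumrB -mulr_sumr bp1 mulr1 sumr_const.
  by rewrite [#|_|](_ : _ = m.+1) ?subrr// -cardC; apply: eq_card.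
pose psi c := (m.+1%:R * bp c - 1) ^+ 2 / (m.+1%:R * bp c + 1).
have psi0 c : 0 <= psi c.
  by rewrite divr_ge0 ?sqr_ge0// addr_ge0// mulr_ge0// ltW.
have ineq1 : 2 * hellinger bp + \sum_c psi c
    <= \sum_c s c * ln (m.+1%:R * bp c).
  rewrite /hellinger mulr_sumr -big_split/=; apply: ler_sum => c _.
  by apply: hellinger_entropy_le; rewrite mulr_gt0.
(* The normaliser contributes a constant times the sum of the s c, which is 0. *)
have entE : \sum_c s c * ln (m.+1%:R * bp c)
    = \sum_(i | P i) \sum_c s c * ln (1 - p i c).
  have lnE c : ln (m.+1%:R * bp c) =
      \sum_(i | P i) ln (1 - p i c) + ln (m.+1%:R / \sum_b X b).
    rewrite bpE mulrCA lnM ?posrE ?divr_gt0//; congr (_ + _).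
    have -> : X c = expR (\sum_(i | P i) ln (1 - p i c)).
      rewrite expR_sum; apply: eq_bigr => i Pi.
      by rewrite lnK// posrE factor_gt0.
    by rewrite expRK.
  under eq_bigr do rewrite lnE mulrDr.
  rewrite big_split/= -mulr_suml s0 mul0r addr0 exchange_big/=.
  by apply: eq_bigr => c _; rewrite mulr_sumr.
(* Up to a constant, ln (1 - p i c) is - a i c / (m - 1). *)
have term i : P i -> (m%:R - 1) * \sum_c s c * ln (1 - p i c)
    <= \sum_c psi c + 2 * (contraction_rate R m * B).
  move=> Pi.
  have -> : (m%:R - 1) * \sum_c s c * ln (1 - p i c) = \sum_c - (s c * a i c).
    have -> : \sum_c - (s c * a i c) = \sum_c (m%:R - 1) * (s c * ln (1 - p i c))
        + (m%:R - 1) * ln (m.+1%:R / m%:R) * \sum_c s c.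
      rewrite mulr_sumr -big_split/=; apply: eq_bigr => c _; rewrite /a.
      rewrite lnM ?posrE ?factor_gt0// ?divr_gt0//; lra.
    by rewrite s0 mulr0 addr0 mulr_sumr.
  apply: (@le_trans _ _ (\sum_c (psi c + 2 * (Num.sqrt (1 + a i c) - 1) ^+ 2))).
    by apply: ler_sum => c _; apply: hellinger_dual; [rewrite mulr_gt0|exact: a_ge].
  rewrite big_split/= lerD2l -mulr_sumr ler_pM2l//.
  apply: (@le_trans _ _ (contraction_rate R m * hellinger (p i))); last by rewrite ler_wpM2l ?hB.
  rewrite mulr_sumr; apply: ler_sum => c _.
  have -> : m.+1%:R * p i c = 1 + t i c by rewrite /t; lra.
  by apply: sqr_sqrt_sub1_le; rewrite ?l0 ?(ltW l1) ?t_ge//; exact: a_bound.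
have Psi0 : 0 <= \sum_c psi c + 2 * (contraction_rate R m * B).
  by rewrite addr_ge0 ?sumr_ge0// mulr_ge0// mulr_ge0.
have total : \sum_(i | P i) \sum_c s c * ln (1 - p i c)
    <= \sum_c psi c + 2 * (contraction_rate R m * B).
  have [m1|m1] := leqP m 1.
    rewrite big_pred0// => i; apply/negP => Pi.
    by have := cardP; rewrite (cardD1 i) [i \in P]Pi; lia.
  have mR2 : 0 < m%:R - 1 :> R by rewrite subr_gt0 ltr1n.
  rewrite -(ler_pM2l mR2) mulr_sumr.
  apply: le_trans (ler_sum _ term) _.
  rewrite sumr_const -[_ *+ #|_|]mulr_natl ler_wpM2r// lerBrDr natr1 ler_nat.
  exact: cardP.
have := ineq1; rewrite entE; lra.
Qed.

End BeliefPropagation.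

Arguments is_dist {R C} p.
Arguments hellinger {R C} m p.
Arguments bp {R C I} P p c.

Section Iteration.
Variables (R : realType) (C : finType) (m : nat).
Hypothesis cardC : #|C| = m.+1.

Section Levels.
Variables (I : finType) (P : pred I) (p : I -> C -> R).
Hypothesis cardP : (#|P| < m)%N.
Hypothesis distP : forall i, P i -> is_dist (p i).

(** M = 1/2 gives exponent at most 3/2 in [bp_le], and exp (3/2) <= 5. *)
Lemma bp_le_level1 : (forall i c, P i -> p i c <= 1 / 2) ->
  forall c, bp P p c <= 5 / (m%:R + 5).
Proof.
move=> p_le c.
have m1 : 1 <= m%:R :> R by rewrite ler1n (leq_ltn_trans _ cardP).
apply: (@bp_le R C m cardC I P p cardP distP (1 / 2)) => //; try lra.
apply: le_trans (expR3half_le R); rewrite ler_expR.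
rewrite ler_pdivrMr; last lra.
have -> : (2 - 1 / 2) / (2 * (1 - 1 / 2)) = 3 / 2 :> R.
  by rewrite (_ : 2 * (1 - 1 / 2) = 1); lra.
lra.
Qed.

(** M = 5 / (m + 5) gives exponent at most 1 + 3 / (2 m) in [bp_le]; then
exp 1 <= 11/4 and exp x <= 1 / (1 - x). *)
Lemma bp_le_level2 : (2 < m)%N ->
    (forall i c, P i -> p i c <= 5 / (m%:R + 5)) ->
  forall c, bp P p c <= 11 / (4 * m%:R + 5).
Proof.
move=> m2 p_le c.
have m3 : 3 <= m%:R :> R by rewrite (ler_nat R 3 m).
set M := m%:R in m3 p_le *.
have M5 : 0 < M + 5 by lra.
have M23 : 0 < 2 * M - 3 by lra.
pose K : R := 11 / 4 * (2 * M / (2 * M - 3)).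
have K0 : 0 < K by rewrite mulr_gt0 ?divr_gt0//; lra.
have KE : K * (2 * M - 3) = 11 / 2 * M.
  have : 2 * M / (2 * M - 3) * (2 * M - 3) = 2 * M by rewrite divfK// gt_eqF.
  by rewrite /K; lra.
have -> : 11 / (4 * M + 5) = K / (M + K).
  have h1 : 0 < 4 * M + 5 by lra.
  have h2 : 0 < M + K by lra.
  by apply/eqP; rewrite eqr_div ?lt0r_neq0//; apply/eqP; lra.
apply: (@bp_le R C m cardC I P p cardP distP (5 / (M + 5))) => //.
- by rewrite divr_ge0//; lra.
- by rewrite ltr_pdivrMr//; lra.
rewrite -/M.
have M0 : 0 < M by lra.
have vM : M * M^-1 = 1 by rewrite divff// gt_eqF.
have bM : 5 / (M + 5) * (M + 5) = 5 by rewrite divfK// gt_eqF.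
have b1 : 5 / (M + 5) < 1 by rewrite ltr_pdivrMr//; lra.
set b := 5 / (M + 5) in bM b1 *.
have b2 : 0 < 2 * (1 - b) by lra.
set g := (2 - b) / (2 * (1 - b)).
have gE : g * (2 * (1 - b)) = 2 - b by rewrite divfK// gt_eqF.
have gM : g * M = M + 5 / 2.
  have := congr1 (fun t => t * (M + 5)) gE.
  have := congr1 (fun t => g * t) bM; lra.
have gv : g = 1 + 5 / 2 * M^-1.
  by have := congr1 (fun t => t * M^-1) gM; have := congr1 (fun t => g * t) vM; lra.
have -> : (M - 1) * g / M = 1 + (3 / 2 / M - 5 / 2 / M / M).
  by have := congr1 (fun t => g * t) vM; rewrite gv; lra.
rewrite expRD; apply: ler_pM; rewrite ?expR_ge0 ?expR1_le//.
apply: (@le_trans _ _ (expR (3 / 2 / M))).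
  rewrite ler_expR; suff : 0 <= 5 / 2 / M / M by lra.
  by rewrite !divr_ge0//; lra.
have := expR_ge1Dx (- (3 / 2 / M)).
rewrite expRN => h.
have E0 := expR_gt0 (3 / 2 / M).
rewrite ler_pdivlMr//.
move: h; rewrite -[(expR _)^-1]mul1r ler_pdivlMr// => h.
have : 2 * M * ((1 - 3 / 2 / M) * expR (3 / 2 / M)) <= 2 * M * 1.
  by rewrite ler_pM2l//; lra.
by have := congr1 (fun t => expR (3 / 2 / M) * t) vM; lra.
Qed.

End Levels.

Lemma hellinger_le (p : C -> R) : is_dist p -> hellinger m p <= 2 * m.+1%:R.
Proof.
move=> [p0 p1]; rewrite /hellinger.
apply: (@le_trans _ _ (\sum_c (m.+1%:R * p c + 1))).
  apply: ler_sum => c _; rewrite sqrrB1 sqr_sqrtr ?mulr_ge0//.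
  have := sqrtr_ge0 (m.+1%:R * p c); lra.
by rewrite big_split/= -mulr_sumr p1 sumr_const cardC; lra.
Qed.

Lemma dist_le1 (p : C -> R) : is_dist p -> forall c, p c <= 1.
Proof.
by move=> [p0 p1] c; rewrite -p1 (bigD1 c)//= lerDl sumr_ge0.
Qed.

(** Factor q p(c) - 1 = (u - 1) (u + 1) with u = sqrt (q p(c)) <= sqrt q. *)
Lemma sqr_sub_le_hellinger (p : C -> R) : is_dist p -> forall c,
  (p c - m.+1%:R^-1) ^+ 2 <= 4 * m.+1%:R * hellinger m p.
Proof.
move=> dp c; have [p0 p1] := dp; have pc1 := dist_le1 _ dp c.
have q1 : 1 <= m.+1%:R :> R by rewrite ler1n.
set q := m.+1%:R in q1 *.
have hc : (Num.sqrt (q * p c) - 1) ^+ 2 <= hellinger m p.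
  by rewrite /hellinger (bigD1 c)//= lerDl sumr_ge0// => b _; rewrite sqr_ge0.
have pc0 := p0 c.
have qp0 : 0 <= q * p c by rewrite mulr_ge0//; lra.
set u := Num.sqrt _ in hc.
have uE : u ^+ 2 = q * p c by rewrite sqr_sqrtr.
have u0 : 0 <= u by exact: sqrtr_ge0.
have e1 : (p c - q^-1) * q = u ^+ 2 - 1.
  by rewrite uE mulrBl mulVf ?gt_eqF// ?[p c * q]mulrC//; lra.
have e2 : (p c - q^-1) ^+ 2 <= (u ^+ 2 - 1) ^+ 2.
  by rewrite -e1 exprMn ler_peMr ?sqr_ge0//; nra.
apply: (le_trans e2).
apply: (@le_trans _ _ ((u - 1) ^+ 2 * (4 * q))).
  have -> : (u ^+ 2 - 1) ^+ 2 = (u - 1) ^+ 2 * (u + 1) ^+ 2 by lra.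
  rewrite ler_wpM2l ?sqr_ge0//.
  have : u ^+ 2 <= q by rewrite uE; nra.
  nra.
rewrite mulrC ler_wpM2l//; lra.
Qed.

End Iteration.

(** * Colourings with a boundary condition *)
Section Colourings.
Set Implicit Arguments.
Unset Strict Implicit.
Variables (T C : finType).
Implicit Types (e : rel T) (A K : {set T}) (t x y : {ffun T -> C}).

Definition respects e x := [forall u, forall v, e u v ==> (x u != x v)].

(** Proper colourings that agree with t outside A.  Keeping the colours outside A
as part of the function, and deleting nodes by deleting their edges, makes all
colourings functions on the same set of nodes. *)
Definition ext e A t : {set {ffun T -> C}} :=
  [set x | respects e x & [forall u, (u \notin A) ==> (x u == t u)]].

Definition del e v : rel T := fun u w => [&& u != v, w != v & e u w].

Definition recolour x v b : {ffun T -> C} :=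
  [ffun u => if u == v then b else x u].

Lemma respectsP e x : reflect (forall u v, e u v -> x u != x v) (respects e x).
Proof.
apply: (iffP forallP) => [h u v euv|h u].
  by have /forallP/(_ v)/implyP := h u; exact.
by apply/forallP => v; apply/implyP; exact: h.
Qed.

Lemma extP e A t x :
  reflect ((forall u v, e u v -> x u != x v) /\
           (forall u, u \notin A -> x u = t u)) (x \in ext e A t).
Proof.
rewrite inE; apply: (iffP andP) => -[h1 h2]; split; try exact/respectsP.
  by move=> u uA; have /forallP/(_ u)/implyP/(_ uA)/eqP := h2.
by apply/forallP => u; apply/implyP => /h2 ->.
Qed.

Lemma ext_self e A t : respects e t -> t \in ext e A t.
Proof. by move/respectsP => h; apply/extP. Qed.

Lemma sub_respects e e' x : subrel e' e -> respects e x -> respects e' x.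
Proof. by move=> s /respectsP h; apply/respectsP => u v /s; exact: h. Qed.

Lemma sub_del e v : subrel (del e v) e.
Proof. by move=> u w /and3P[]. Qed.

Lemma del_sym e v : symmetric e -> symmetric (del e v).
Proof. by move=> s u w; rewrite /del s; case: (u == v); case: (w == v). Qed.

Definition avoiding e v c : pred {ffun T -> C} :=
  fun x => [forall u, e v u ==> (x u != c)].

Lemma recolour_respects e v b x : symmetric e -> irreflexive e ->
  respects (del e v) x -> avoiding e v b x -> respects e (recolour x v b).
Proof.
move=> es ei /respectsP hx /forallP av; apply/respectsP => u w euw.
rewrite !ffunE; have [uv|uv] := eqVneq u v; have [wv|wv] := eqVneq w v.
- by move: euw; rewrite uv wv ei.
- by rewrite eq_sym; apply: (implyP (av w)); rewrite -uv.
- by apply: (implyP (av u)); rewrite es -wv.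
- by apply: hx; rewrite /del uv wv.
Qed.

(** In the graph without the edges at v the colour of v is free, so each colouring
avoiding c around v comes from one colouring with colour c at v and one arbitrary
colour. *)
Lemma card_ext_free e A t v c : symmetric e -> irreflexive e -> v \in A ->
  (#|[set x in ext e A t | x v == c]| * #|C|
   = #|[set x in ext (del e v) A t | avoiding e v c x]|)%N.
Proof.
move=> es ei vA; rewrite -cardsT -cardsX.
have recE x u b : u != v -> recolour x v b u = x u.
  by rewrite ffunE => /negPf ->.
have recv x b : recolour x v b v = b by rewrite ffunE eqxx.
have outA u : u \notin A -> u != v by apply: contraNneq => ->.
pose f := fun xb : {ffun T -> C} * C => recolour xb.1 v xb.2.
rewrite -(@card_in_imset _ _ f).
  apply: eq_card => y; apply/imsetP/setIdP => [[[x b] /= /setXP[/setIdP[/extP[h1 h2] /eqP xv] _] ->]|].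
    rewrite /f/=; split.
      apply/extP; split=> [u w /and3P[uv wv euw]|u uA].
        by rewrite !recE// h1.
      by rewrite recE ?outA// h2.
    apply/forallP => u; apply/implyP => evu.
    have uv : u != v by apply: contraTneq evu => ->; rewrite ei.
    by rewrite recE// -xv eq_sym h1.
  move=> [/extP[h1 h2] av].
  exists (recolour y v c, y v); last first.
    by apply/ffunP => u; rewrite /f !ffunE/=; case: eqP => [->|].
  apply/setXP; split; last by rewrite inE.
  apply/setIdP; split; last by rewrite /= recv.
  apply/extP; split=> [|u uA]; last by rewrite recE ?outA// h2.
  by apply/respectsP/recolour_respects => //; exact/respectsP.
move=> [x b] [x' b'] /setXP[/setIdP[_ /eqP/= xv] _] /setXP[/setIdP[_ /eqP/= xv'] _].
rewrite /f /= => /ffunP h; congr pair; last by have := h v; rewrite !recv.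
apply/ffunP => u; have := h u.
by have [->|uv] := eqVneq u v; [rewrite xv xv'|rewrite !recE].
Qed.

Definition inner e A : rel T := fun u w => [&& u \in A, w \in A & e u w].

Lemma inner_sym e A : symmetric e -> symmetric (inner e A).
Proof. by move=> s u w; rewrite /inner s andbCA. Qed.

(** Exchanging two colourings on K is an involution of pairs of colourings: no edge
inside A leaves K, and outside A both colourings agree.  It shows that events
depending on K and on its complement are independent. *)
Lemma card_ext_swap e A t (K : {set T}) (Q1 Q2 : pred {ffun T -> C}) :
    symmetric e ->
    (forall u w, inner e A u w -> u \in K -> w \in K) ->
    (forall x y, {in K, x =1 y} -> Q1 x = Q1 y) ->
    (forall x y, {in ~: K, x =1 y} -> Q2 x = Q2 y) ->
  (#|[set x in ext e A t | Q1 x && Q2 x]| * #|ext e A t|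
   = #|[set x in ext e A t | Q1 x]| * #|[set x in ext e A t | Q2 x]|)%N.
Proof.
move=> es clos hQ1 hQ2; rewrite -!cardsX.
have closC u w : inner e A u w -> u \notin K -> w \notin K.
  by move=> iuw; apply: contraNN; apply: clos; rewrite inner_sym.
pose mix x y : {ffun T -> C} := [ffun u => if u \in K then x u else y u].
have mixK x y u : u \in K -> mix x y u = x u by rewrite ffunE => ->.
have mixNK x y u : u \notin K -> mix x y u = y u by rewrite ffunE => /negPf ->.
have mix_ext x y : x \in ext e A t -> y \in ext e A t -> mix x y \in ext e A t.
  move=> /extP[x1 x2] /extP[y1 y2]; apply/extP; split; last first.
    by move=> u uA; rewrite ffunE; case: ifP => _; [exact: x2|exact: y2].
  move=> u w euw; have [uA|uA] := boolP (u \in A); last first.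
    have -> : mix x y u = x u by rewrite ffunE; case: ifP => // _; rewrite x2// y2.
    have [wK|wK] := boolP (w \in K); first by rewrite mixK// x1.
    by rewrite mixNK// x2// -(y2 _ uA) y1.
  have [wA|wA] := boolP (w \in A); last first.
    have -> : mix x y w = x w by rewrite ffunE; case: ifP => // _; rewrite x2// y2.
    have [uK|uK] := boolP (u \in K); first by rewrite mixK// x1.
    by rewrite mixNK// x2// -(y2 _ wA) y1.
  have iuw : inner e A u w by rewrite /inner uA wA.
  have [uK|uK] := boolP (u \in K).
    by rewrite !mixK ?(clos _ _ iuw)// x1.
  by rewrite !mixNK ?(closC _ _ iuw)// y1.
have mixl x y : {in K, mix x y =1 x} by move=> u; exact: mixK.
have mixr x y : {in ~: K, mix x y =1 y} by move=> u; rewrite inE; exact: mixNK.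
pose f := fun xy : {ffun T -> C} * {ffun T -> C} => (mix xy.1 xy.2, mix xy.2 xy.1).
have fK : involutive f.
  by case=> x y; rewrite /f/=; congr pair; apply/ffunP => u;
    (case: (boolP (u \in K)) => uK; [rewrite !mixK|rewrite !mixNK]).
rewrite -(card_imset _ (inv_inj fK)); apply: eq_card => -[x y].
apply/imsetP/setXP => [[[x' y'] /setXP[/setIdP[hx' /andP[q1 q2]] hy'] [-> ->]]|].
  split; apply/setIdP; split; rewrite ?mix_ext//=.
    by rewrite (hQ1 _ _ (mixl x' y')).
  by rewrite (hQ2 _ _ (mixr y' x')).
move=> [/setIdP[hx q1] /setIdP[hy q2]]; exists (f (x, y)); last by rewrite fK.
apply/setXP; split; rewrite ?mix_ext//=; apply/setIdP; split; rewrite ?mix_ext//.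
by rewrite (hQ1 _ _ (mixl x y)) (hQ2 _ _ (mixr x y)) q1.
Qed.

End Colourings.

Section Marginals.
Set Implicit Arguments.
Unset Strict Implicit.
Variables (R : realType) (T C : finType).
Implicit Types (e : rel T) (A : {set T}) (t x : {ffun T -> C}).

Definition marg e A t v c : R :=
  #|[set x in ext e A t | x v == c]|%:R / #|ext e A t|%:R.

(** Only cycles contained in A count: a cycle through a node of fixed colour
creates no dependence. *)
Definition acyclic e A := forall s : seq T,
  (2 < size s)%N -> ucycleb e s -> ~~ all [in A] s.

Lemma card_ext_gt0 e A t : respects e t -> (0 < #|ext e A t|)%N.
Proof. by move=> h; apply/card_gt0P; exists t; exact: ext_self. Qed.

Lemma card_extR_gt0 e A t : respects e t -> 0 < #|ext e A t|%:R :> R.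
Proof. by move=> h; rewrite ltr0n card_ext_gt0. Qed.

Lemma card_fibres (E : {set {ffun T -> C}}) v :
  (#|E| = \sum_c #|[set x in E | x v == c]|)%N.
Proof.
rewrite -sum1_card (partition_big (fun x : {ffun T -> C} => x v) predT)//=.
by apply: eq_bigr => c _; rewrite -sum1_card; apply: eq_bigl => x; rewrite !inE.
Qed.

Lemma marg_dist e A t v : respects e t -> is_dist (marg e A t v).
Proof.
move=> h; split=> [c|]; first by rewrite divr_ge0.
by rewrite -mulr_suml -natr_sum -card_fibres divff// gt_eqF// card_extR_gt0.
Qed.

Lemma marg_neq e A t v c : respects e t ->
  #|[set x in ext e A t | x v != c]|%:R / #|ext e A t|%:R = 1 - marg e A t v c.
Proof.
move=> h; have N0 := lt0r_neq0 (card_extR_gt0 A h).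
apply: (mulIf N0); rewrite divfK// mulrBl mul1r divfK//.
apply/eqP; rewrite eq_sym subr_eq -natrD eqr_nat; apply/eqP.
rewrite addnC -(cardsID [set x : {ffun T -> C} | x v == c] (ext e A t)).
by congr (_ + _)%N; apply: eq_card => x; rewrite !inE// andbC.
Qed.

(** Nodes in different components of A are independent: split off the component of
the first node with [card_ext_swap]. *)
Lemma card_avoid_seq e A t c (s : seq T) : symmetric e -> respects e t ->
    uniq s ->
    {in s &, forall u w, u != w -> ~~ connect (inner e A) u w} ->
  #|[set x in ext e A t | all (fun u => x u != c) s]|%:R / #|ext e A t|%:R
  = \prod_(u <- s) (1 - marg e A t u c).
Proof.
move=> es ht; have N0 := lt0r_neq0 (card_extR_gt0 A ht).
elim: s => [_ _|u s IH /= /andP[us uniqs] hs].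
  rewrite big_nil -[RHS](divff N0); congr (_%:R / _).
  by apply: eq_card => x; rewrite inE/= andbT.
rewrite big_cons -IH//; last first.
  by move=> a b as_ bs; apply: hs; rewrite inE ?as_ ?bs orbT.
rewrite -marg_neq//.
pose K : {set T} := [set w | connect (inner e A) u w]%SET.
have clos a b : inner e A a b -> a \in K -> b \in K.
  by rewrite !inE => iab /connect_trans; apply; exact: connect1.
pose Q1 := [pred x : {ffun T -> C} | x u != c].
pose Q2 := [pred x : {ffun T -> C} | all (fun u => x u != c) s].
have q1 (x y : {ffun T -> C}) : {in K, x =1 y} -> Q1 x = Q1 y.
  by move=> xy; rewrite /= xy// inE connect0.
have q2 (x y : {ffun T -> C}) : {in (~: K)%SET, x =1 y} -> Q2 x = Q2 y.
  move=> xy; apply: eq_in_all => w ws; rewrite xy// !inE hs ?inE ?eqxx ?ws ?orbT//.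
  by apply: contraNneq us => ->.
have swap := @card_ext_swap _ _ e A t K Q1 Q2 es clos q1 q2.
apply: (mulIf N0); apply: (mulIf N0).
by rewrite divfK// -natrM swap natrM -[RHS]mulrA [RHS]mulrACA !divfK.
Qed.

(** A simple path between two neighbours of v that avoids v closes up to a cycle
through v. *)
Lemma ucycle_del e v u p : symmetric e -> irreflexive e -> e v u -> e v (last u p) ->
  path (del e v) u p -> uniq (u :: p) -> ucycleb e [:: v, u & p].
Proof.
move=> es ei evu evw pth up.
rewrite /ucycleb /= rcons_path evu (sub_path (sub_del (e:=e) (v:=v)) pth) es evw/=.
suff : v \notin u :: p by rewrite /= in up * => ->.
rewrite inE negb_or; apply/andP; split.
  by apply: contraTneq evu => ->; rewrite ei.
elim: p u {evu evw up} pth => // w p IH u /= /andP[/and3P[_ wv _] /IH h].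
by rewrite inE negb_or eq_sym wv h.
Qed.

End Marginals.

(** * Decay of the influence of the boundary *)
Section Decay.
Set Implicit Arguments.
Unset Strict Implicit.
Variables (R : realType) (T C : finType) (m : nat).
Hypothesis cardC : #|C| = m.+1.
Implicit Types (e : rel T) (A : {set T}) (t x : {ffun T -> C}).

Definition tame e A := [/\ symmetric e, irreflexive e, acyclic e A
  & forall u, (#|e u| <= m)%N].

(** The node v is at distance more than k from the complement of A.  Stated with
paths, the property passes to the neighbours of v after the deletion of v. *)
Definition deep e A v k := forall p, path e v p -> (size p <= k)%N -> last v p \in A.

Lemma tame_del e A v : tame e A -> tame (del e v) A.
Proof.
move=> [es ei ac dg]; split; first exact: del_sym.
- by move=> u; rewrite /del ei !andbF.
- move=> s s2 /andP[/sub_cycle cyc us]; apply: ac => //; apply/andP; split=> //.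
  by apply: cyc; exact: sub_del.
- move=> u; apply: leq_trans (dg u); apply: subset_leq_card; apply/fintype.subsetP => w.
  exact: sub_del.
Qed.

Lemma degree_del e A v u : tame e A -> e v u -> (#|del e v u| < m)%N.
Proof.
move=> [es ei _ dg] evu; apply: leq_trans (dg u).
have vu : v \in e u by rewrite unfold_in es.
rewrite [X in (_ < X)%N](cardD1 v) vu.
apply: subset_leq_card; apply/fintype.subsetP => w.
by rewrite !inE !unfold_in => /and3P[_ -> ->].
Qed.

Lemma deep_del e A v u k : e v u -> deep e A v k.+1 -> deep (del e v) A u k.
Proof.
move=> evu dp p pth sp; apply: (dp (u :: p)) => //=.
by rewrite evu (sub_path (sub_del (e:=e) (v:=v)) pth).
Qed.

Lemma deep_mem e A v k : deep e A v k -> v \in A.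
Proof. by move=> /(_ [::]); exact. Qed.

Lemma deepW e A v k l : (l <= k)%N -> deep e A v k -> deep e A v l.
Proof. by move=> lk dp p pth sp; apply: dp => //; exact: leq_trans lk. Qed.

Lemma path_inner e A u p : path (inner e A) u p -> all [in A] p.
Proof. by elim: p u => //= w p IH u /andP[/and3P[_ -> _] /IH]. Qed.

(** A path between two neighbours of v in A minus v would close up to a cycle. *)
Lemma neighbours_disconnected e A v u w : tame e A -> v \in A ->
  e v u -> e v w -> u != w -> ~~ connect (inner (del e v) A) u w.
Proof.
move=> [es ei ac _] vA evu evw uw; apply/negP => /connectP[p pth lastp].
move: uw evw; rewrite lastp; case/shortenP: pth => p' pth' up' _ uw evw.
have pthe : path (del e v) u p'.
  by apply: sub_path pth' => a b /and3P[].
have sp : (0 < size p')%N by case: (p') uw => //=; rewrite eqxx.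
have /negP := ac [:: v, u & p'] sp (ucycle_del es ei evu evw pthe up').
apply; rewrite /= vA (path_inner pth') andbT /=.
by case: p' pth' sp {up' uw evw pthe} => //= a p' /andP[/and3P[]].
Qed.

Lemma avoiding_prob e A t v c : tame e A -> v \in A -> respects (del e v) t ->
  #|[set x in ext (del e v) A t | avoiding e v c x]|%:R
    / #|ext (del e v) A t|%:R
  = \prod_(u | e v u) (1 - marg R (del e v) A t u c).
Proof.
move=> te vA ht'; have [es _ _ _] := te.
have := @card_avoid_seq R T C (del e v) A t c (enum (e v)) (del_sym v es) ht'
  (enum_uniq _).
rewrite big_enum/= => <-; last first.
  by move=> u w; rewrite !mem_enum => evu evw; exact: neighbours_disconnected.
congr (_%:R / _); apply: eq_card => x; rewrite !inE; congr (_ && _).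
apply/forallP/allP => [h u|h u]; first by rewrite mem_enum => evu; exact: (implyP (h u)).
by apply/implyP => evu; apply: h; rewrite mem_enum.
Qed.

Lemma marg_bp e A t v c : tame e A -> v \in A -> respects e t ->
  marg R e A t v c = bp (e v) (marg R (del e v) A t) c.
Proof.
move=> te vA ht; have [es ei _ _] := te.
have ht' : respects (del e v) t by apply: sub_respects ht; exact: sub_del.
have q0 : #|C|%:R != 0 :> R by rewrite cardC pnatr_eq0.
have N0 := lt0r_neq0 (card_extR_gt0 R A ht').
rewrite /bp -avoiding_prob//.
under [in RHS]eq_bigr do rewrite -avoiding_prob//.
under [in RHS]eq_bigr do rewrite -card_ext_free// natrM.
rewrite -card_ext_free// natrM -!mulr_suml -natr_sum -card_fibres.
rewrite /marg; set k := #|[set _ in _ | _]|; set n := #|_|.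
rewrite -(mulrA k%:R) -(mulrA n%:R) invfM mulrACA.
by rewrite divff ?mulf_neq0 ?invr_eq0// mulr1.
Qed.

(** A node with at most q - 2 neighbours always has another free colour.  Recolouring
with it maps the colourings with colour c at v injectively to the others. *)
Lemma marg_le_half e A t v c : tame e A -> v \in A -> respects e t ->
  (#|e v| < m)%N -> marg R e A t v c <= 1 / 2.
Proof.
move=> [es ei _ _] vA ht dv.
have N0 := card_extR_gt0 R A ht.
rewrite /marg ler_pdivrMr// mulrAC ler_pdivlMr// mul1r -natrM ler_nat.
rewrite -(cardsID [set x : {ffun T -> C} | x v == c] (ext e A t)).
set D := (_ :\: _)%SET.
rewrite muln2 -addnn leq_add//.
  by apply: subset_leq_card; apply/fintype.subsetP => x; rewrite !inE andbC.
(* Neither c nor a colour used around v, so at most 1 + (m - 1) < q are excluded. *)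
pose free (x : {ffun T -> C}) b := (b != c) && avoiding e v b x.
pose f (x : {ffun T -> C}) := recolour x v (odflt c [pick b | free x b]).
have fP x : free x (odflt c [pick b | free x b]).
  case: pickP => [b //|no].
  have : (#|[set: C]%SET| <= #|(c |: [set x u | u in e v])%SET|)%N.
    apply: subset_leq_card; apply/fintype.subsetP => b _.
    have := no b; rewrite /free /avoiding !inE; case: eqP => //= _ /negbT.
    rewrite negb_forall => /existsP[u]; rewrite negb_imply negbK => /andP[evu /eqP <-].
    by apply/imsetP; exists u.
  rewrite cardsT cardC cardsU1 => h; exfalso; move: h.
  apply/negP; rewrite -ltnNge ltnS; apply: leq_trans (leq_add (leq_b1 _) (leq_imset_card _ _)) _.
  by rewrite add1n.
have recE (x : {ffun T -> C}) u b : u != v -> recolour x v b u = x u.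
  by rewrite ffunE => /negPf ->.
rewrite -(@card_in_imset _ _ f [set x in ext e A t | x v == c]%SET); last first.
  move=> x y /setIdP[_ /eqP xv] /setIdP[_ /eqP yv] /ffunP h.
  apply/ffunP => u; have [->|uv] := eqVneq u v; first by rewrite xv yv.
  by have := h u; rewrite !recE.
apply: subset_leq_card; apply/fintype.subsetP => _ /imsetP[x /setIdP[/extP[x1 x2] _] ->].
have /andP[bc bav] := fP x.
rewrite /D finset.in_setD finset.in_set /f; set b := odflt _ _ in bc bav *.
rewrite {1}ffunE eqxx bc/=; apply/extP; split=> [|u uA]; last first.
  by rewrite recE ?x2//; apply: contraNneq uA => ->.
apply/respectsP/recolour_respects => //.
by apply: (sub_respects (sub_del (e := e) (v := v))); exact/respectsP.
Qed.

Lemma marg_level1 e A t v c : tame e A -> deep e A v 1 -> respects e t ->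
  (#|e v| < m)%N -> marg R e A t v c <= 5 / (m%:R + 5).
Proof.
move=> te dp ht dv; have vA := deep_mem dp.
have ht' : respects (del e v) t by apply: sub_respects ht; exact: sub_del.
rewrite marg_bp//; apply: bp_le_level1 => //; first by move=> i _; exact: marg_dist.
move=> u b evu; apply: marg_le_half => //; first exact: tame_del.
  exact: deep_mem (deep_del evu dp).
exact: degree_del te evu.
Qed.

Lemma marg_level2 e A t v c : tame e A -> deep e A v 2 -> respects e t ->
  (#|e v| < m)%N -> marg R e A t v c <= marg_cap R m.
Proof.
move=> te dp ht dv; have vA := deep_mem dp; rewrite /marg_cap.
case: leqP => m4; first exact: marg_le_half.
have ht' : respects (del e v) t by apply: sub_respects ht; exact: sub_del.
rewrite marg_bp//; apply: bp_le_level2 => //; last 2 first.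
- exact: leq_trans m4.
- move=> u b evu; apply: marg_level1 => //; first exact: tame_del.
    exact: deep_del evu dp.
  exact: degree_del te evu.
by move=> i _; exact: marg_dist.
Qed.

(** Two levels are spent on bounding the marginals; every further level gains a
factor [contraction_rate]. *)
Lemma hellinger_marg_le k e A t v : tame e A -> deep e A v k.+2 ->
    respects e t -> (#|e v| < m)%N ->
  hellinger m (marg R e A t v) <= contraction_rate R m ^+ k * (2 * m.+1%:R).
Proof.
elim: k e v => [|k IH] e v te dp ht dv.
  by rewrite mul1r; apply: hellinger_le => //; exact: marg_dist.
have vA := deep_mem dp.
have ht' : respects (del e v) t by apply: sub_respects ht; exact: sub_del.
have m0 : (0 < m)%N by exact: leq_ltn_trans dv.
have /andP[l0 _] := contraction_rate_bounds R m m0.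
have -> : marg R e A t v = bp (e v) (marg R (del e v) A t).
  by apply/funext => c; exact: marg_bp.
rewrite exprS -mulrA; apply: hellinger_bp_le => //.
- by move=> i _; exact: marg_dist.
- move=> u b evu; apply: marg_level2 => //; first exact: tame_del.
    by apply: (deepW _ (deep_del evu dp)).
  exact: degree_del te evu.
- by rewrite mulr_ge0 ?exprn_ge0.
- move=> u evu; apply: IH => //; first exact: tame_del.
    exact: deep_del evu dp.
  exact: degree_del te evu.
Qed.

(** Uniqueness of the Gibbs measure with exponential decay: the bound does not depend
on the boundary colouring t. *)
Lemma marg_near_uniform k e A t v c : tame e A -> deep e A v k.+2 ->
    respects e t -> (#|e v| < m)%N ->
  (marg R e A t v c - m.+1%:R^-1) ^+ 2 <= contraction_rate R m ^+ k * (8 * m.+1%:R ^+ 2).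
Proof.
move=> te dp ht dv.
apply: le_trans (sqr_sub_le_hellinger R C m _ (marg_dist R A v ht) c) _.
have := hellinger_marg_le te dp ht dv.
set q := m.+1%:R; set h := hellinger _ _ => hh.
apply: (@le_trans _ _ (4 * q * (contraction_rate R m ^+ k * (2 * q)))).
  by rewrite ler_wpM2l// mulr_ge0.
by rewrite le_eqVlt; apply/orP; left; apply/eqP; lra.
Qed.

End Decay.

(** * Balls in graphs of large girth are trees *)
Section Balls.
Set Implicit Arguments.
Unset Strict Implicit.
Variable T : finType.
Implicit Types (e : rel T) (u v w : T).

Definition reach e k v w :=
  exists p, [/\ path e v p, (size p <= k)%N & last v p = w].

Definition ball e k v : {set T} := [set w | `[< reach e k v w >]]%SET.

Definition girth_gt e l :=
  forall s : seq T, (2 < size s)%N -> ucycleb e s -> (l < size s)%N.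

Lemma reach_sym e k v w : symmetric e -> reach e k v w -> reach e k w v.
Proof.
move=> es [p [pth sp <-]]; exists (rev (belast v p)); split.
- by rewrite rev_path; apply: sub_path pth => a b; rewrite es.
- by rewrite size_rev size_belast.
- by case: p {pth sp} => //= a p; rewrite rev_cons last_rcons.
Qed.

Lemma reach_trans e k l u v w :
  reach e k u v -> reach e l v w -> reach e (k + l) u w.
Proof.
move=> [p [pp sp <-]] [p' [pp' sp' <-]]; exists (p ++ p'); split.
- by rewrite cat_path pp.
- by rewrite size_cat leq_add.
- by rewrite last_cat.
Qed.

Lemma reach1 e v w : e v w -> reach e 1 v w.
Proof. by move=> evw; exists [:: w]; rewrite /= evw. Qed.

Lemma in_ball e k v w : (w \in ball e k v) <-> reach e k v w.
Proof. by rewrite inE; split=> /asboolP. Qed.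

Lemma deep_ball e k v : deep e (ball e k v) v k.
Proof. by move=> p pth sp; apply/in_ball; exists p. Qed.

Lemma ball_del e k v w : w \in ball e k.+1 v -> w != v ->
  exists2 u, e v u & w \in ball (del e v) k u.
Proof.
move=> /in_ball[p [pth sp lw]]; rewrite -lw => {lw}.
have [p' pth' up' sub'] := shortenP pth.
have {}sp : (size p' <= k.+1)%N.
  apply: leq_trans sp; apply: uniq_leq_size; first by case/andP: up'.
  by move=> x; exact: sub'.
case: p' pth' up' sp {sub'} => [|u p'] /=; first by rewrite eqxx.
move=> /andP[evu pth'] /andP[vn _] sp _; exists u => //.
apply/in_ball; exists p'; split => //.
elim: p' u vn pth' {evu sp} => //= a p' IH u vn /andP[eua pth'].
move: vn; rewrite inE negb_or => /andP[vu vn].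
rewrite IH// andbT /del eua andbT eq_sym vu /=.
by move: vn; rewrite inE negb_or eq_sym => /andP[].
Qed.

(** A walk of length l between different neighbours of v avoiding v contains a
simple path, and so creates a cycle with at most l + 2 nodes. *)
Lemma reach_neighbours e l v u w : symmetric e -> irreflexive e ->
    girth_gt e l.+2 -> e v u -> e v w -> reach (del e v) l u w ->
  u = w.
Proof.
move=> es ei gt evu evw [p [pth sp lw]]; apply/eqP; apply: contraT => uw.
move: evw uw; rewrite -lw => {lw}.
have [p' pth' up' sub'] := shortenP pth => evw uw.
have {}sp : (size p' <= l)%N.
  apply: leq_trans sp; apply: uniq_leq_size; first by case/andP: up'.
  by move=> x; exact: sub'.
have p'0 : (0 < size p')%N by case: (p') uw => //=; rewrite eqxx.
have := gt [:: v, u & p'] p'0 (ucycle_del es ei evu evw pth' up').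
by rewrite /= !ltnS leqNgt ltnS sp.
Qed.

Lemma girth_gt_sub e e' l : subrel e' e -> girth_gt e l -> girth_gt e' l.
Proof.
move=> s gt c c2 /andP[cyc uc]; apply: gt => //; apply/andP; split=> //.
exact: sub_cycle cyc.
Qed.

Lemma girth_gtW e k l : (k <= l)%N -> girth_gt e l -> girth_gt e k.
Proof. by move=> kl gt c c2 /gt h; apply: leq_ltn_trans (h c2). Qed.

(** Each node of the ball other than v lies in the ball of radius k around some
neighbour of v.  Two adjacent nodes on branches of different neighbours would give
a walk of length 2 k + 1 between these neighbours. *)
Lemma ball_path_same_branch e k v u x p : symmetric e -> irreflexive e ->
    girth_gt e (k.+1).*2.+1 -> e v u -> x \in ball (del e v) k u ->
    path (del e v) x p -> all [in ball e k.+1 v] p ->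
  all [in ball (del e v) k u] p.
Proof.
move=> es ei gt evu; elim: p x => //= y p IH x xu /andP[exy pth] /andP[yb pb].
have es' := del_sym v es.
suff yu : y \in ball (del e v) k u by rewrite yu (IH y).
have yv : y != v by case/and3P: exy.
have [w evw yw] := ball_del yb yv.
suff -> : u = w by [].
apply: (reach_neighbours es ei (l := (k + 1 + k)%N) _ evu evw).
  by apply: girth_gtW gt; rewrite -addnn; lia.
apply: reach_trans (reach_sym es' (iffLR (in_ball _ _ _ _) yw)).
by apply: reach_trans (reach1 exy); apply/in_ball.
Qed.

(** Induction on the radius.  By [ball_path_same_branch] a cycle that avoids v lies
in a single branch, which is a smaller ball; and a cycle through v enters and
leaves v through the same neighbour. *)
Lemma ball_acyclic k e v : symmetric e -> irreflexive e ->
  girth_gt e k.*2.+1 -> acyclic e (ball e k v).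
Proof.
elim: k e v => [|k IH] e v es ei gt c c2 cyc; apply/negP => cb.
  have b0 w : w \in ball e 0 v -> w = v.
    by move=> /in_ball[p [_ sp <-]]; case: p sp.
  case: c c2 cyc cb => [//|a [//|b c]] _ /andP[_ /= uc] /= /and3P[/b0 av /b0 bv _].
  by move: uc; rewrite av bv !inE eqxx.
have es' := del_sym v es.
have ei' : irreflexive (del e v) by move=> u; rewrite /del ei !andbF.
have gt' : girth_gt (del e v) k.*2.+1.
  apply: (girth_gtW _ (girth_gt_sub (sub_del (e := e) (v := v)) gt)).
  by rewrite ltnS leq_double.
have [vc|vc] := boolP (v \in c); last first.
  have cyc' : ucycleb (del e v) c.
    case/andP: cyc => cyc uc; apply/andP; split=> //.
    apply: (sub_in_cycle (P := [in c])) cyc; last exact/allP.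
    move=> a b ac bc eab; rewrite /del eab andbT.
    by rewrite (contraTneq _ ac)?(contraTneq _ bc)// => ->.
  case: c c2 cyc cb vc cyc' => //= a c c2 cyc /andP[ab cb] vc cyc'.
  have av : a != v by apply: contraNneq vc => ->; rewrite mem_head.
  have [u evu au] := ball_del ab av.
  have := IH (del e v) u es' ei' gt' (a :: c) c2 cyc'; rewrite /= au /= => /negP; apply.
  case/andP: cyc' => /= pth _; move: pth; rewrite rcons_path => /andP[pth _].
  exact: ball_path_same_branch gt evu au pth cb.
have [i c' rc] := rot_to vc.
have {cyc} : ucycleb e (v :: c').
  by rewrite -rc /ucycleb rot_cycle rot_uniq.
have {cb} : all [in ball e k.+1 v] (v :: c') by rewrite -rc (eq_all_r (mem_rot i c)).
have {c2 rc} : (2 < size (v :: c'))%N by rewrite -rc size_rot.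
case: c' => [//|u c'] /= c2 /and3P[_ ub cb] /andP[/= /andP[evu]].
rewrite rcons_path => /andP[pth elast] /andP[vn uc].
have pth' : path (del e v) u c'.
  apply: (sub_in_path (P := predC1 v)) pth.
    by move=> a b; rewrite !inE /del => -> -> ->.
  by apply/allP => w wc; rewrite !inE; apply: contraNneq vn => <-.
have uu : u \in ball (del e v) k u by apply/in_ball; exists [::].
have := ball_path_same_branch es ei gt evu uu pth' cb.
case/lastP: c' c2 {ub cb pth pth'} elast vn uc => // c' w _.
rewrite last_rcons => elast _ /= /andP[un _]; rewrite all_rcons => /andP[wu _].
move: un; rewrite mem_rcons inE negb_or => /andP[/eqP uw _]; apply: uw.
apply: (reach_neighbours es ei (l := k) _ evu); last exact/in_ball.
  by apply: girth_gtW gt; rewrite -addnn; lia.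
by rewrite es.
Qed.

End Balls.

(** * Deleting one node *)
Section Ratio.
Set Implicit Arguments.
Unset Strict Implicit.
Variables (R : realType) (T C : finType) (m : nat).
Hypothesis cardC : #|C| = m.+1.
Implicit Types (e : rel T) (A : {set T}) (t x : {ffun T -> C}).

Definition colourings e : {set {ffun T -> C}} := [set x | respects e x]%SET.

Lemma ext_setT e t : ext e [set: T]%SET t = colourings e.
Proof.
apply/setP => x; rewrite !inE; case: (respects e x) => //=.
by apply/forallP => u; rewrite inE.
Qed.

Lemma ext_mem_eq e A t x : x \in ext e A t -> ext e A x = ext e A t.
Proof.
move=> /extP[_ xt]; apply/setP => y; rewrite !inE; congr (_ && _).
by apply: eq_forallb => u; case: (boolP (u \in A)) => //= uA; rewrite xt.
Qed.

Lemma ext_mem_sym e A t x : respects e t -> x \in ext e A t -> t \in ext e A x.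
Proof. by move=> ht xt; rewrite (ext_mem_eq xt) ext_self. Qed.

(** Law of total probability for the colours outside A.  The sets [ext e A t] are
the classes of the relation of agreeing outside A, so every colouring is counted
once by each member of its class, with weight one over the size of the class. *)
Lemma card_colourings_boundary e A (Q : pred {ffun T -> C}) :
  #|[set x in colourings e | Q x]|%:R
  = \sum_(t in colourings e)
      #|[set x in ext e A t | Q x]|%:R / #|ext e A t|%:R :> R.
Proof.
transitivity (\sum_(t in colourings e) \sum_(x in colourings e | Q x && (x \in ext e A t))
   (#|ext e A x|%:R^-1 : R)); last first.
  apply: eq_bigr => t; rewrite inE => ht.
  rewrite -sum1_card natr_sum mulr_suml; apply: eq_big => [x|x].
    by rewrite !inE; case: (respects e x) => //=; rewrite andbC.
  by move=> /andP[_ /andP[_ xt]]; rewrite (ext_mem_eq xt) mul1r.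
rewrite (exchange_big_dep [pred x | (x \in colourings e) && Q x])/=; last first.
  by move=> t x _ /andP[-> /andP[-> _]].
rewrite -sum1_card natr_sum; apply: eq_big => [x|x]; first by rewrite !inE.
rewrite !inE => /andP[hx Qx].
rewrite (eq_bigl (mem (ext e A x))).
  rewrite sumr_const -[RHS]mulr_natl divff// gt_eqF//.
  exact: card_extR_gt0.
move=> t; rewrite inE hx Qx/=; apply/andP/idP => [[ht xt]|tx].
  exact: ext_mem_sym.
by split; [move: tx; rewrite inE => /andP[]|exact: ext_mem_sym].
Qed.

Lemma card_colourings_del e v : symmetric e -> irreflexive e ->
  (#|colourings e| * #|C|
   = \sum_c #|[set x in colourings (del e v) | avoiding e v c x]|)%N.
Proof.
move=> es ei; rewrite (card_fibres _ v) big_distrl/=; apply: eq_bigr => c _.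
pose t : {ffun T -> C} := [ffun=> c].
rewrite -(ext_setT e t) -(ext_setT (del e v) t).
by apply: card_ext_free => //; rewrite inE.
Qed.

(** Conditionally on the colours outside the ball, the event that no neighbour of v
has colour c is an intersection of independent events whose probabilities are
within h of 1 - 1/q. *)
Lemma colouring_ratio_bounds e v k (h : R) : symmetric e -> irreflexive e ->
    (forall u, (#|e u| <= m)%N) -> girth_gt e (k.+3).*2.+1 ->
    0 <= h -> contraction_rate R m ^+ k * (8 * m.+1%:R ^+ 2) <= h ^+ 2 ->
    h <= 1 - m.+1%:R^-1 ->
  (1 - m.+1%:R^-1 - h) ^+ #|e v| * #|colourings (del e v)|%:R
     <= #|colourings e|%:R
     <= (1 - m.+1%:R^-1 + h) ^+ #|e v| * #|colourings (del e v)|%:R.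
Proof.
move=> es ei dg gt h0 hh h1.
set i := m.+1%:R^-1 in h1 *; set y := 1 - i in h1 *.
pose A := ball e k.+3 v.
have te : tame m e A by split=> //; exact: ball_acyclic.
have dv := deep_ball (e := e) (k := k.+3) (v := v).
have vA : v \in A := deep_mem dv.
have q0 : 0 < #|C|%:R :> R by rewrite cardC ltr0n.
have prob t c : respects (del e v) t ->
    (y - h) ^+ #|e v| <= #|[set x in ext (del e v) A t | avoiding e v c x]|%:R
       / #|ext (del e v) A t|%:R <= (y + h) ^+ #|e v|.
  move=> ht'; rewrite (avoiding_prob R c te vA ht').
  have near u : e v u -> y - h <= 1 - marg R (del e v) A t u c <= y + h.
    move=> evu; have : (marg R (del e v) A t u c - i) ^+ 2 <= h ^+ 2; last first.
      move: (marg _ _ _ _ _ _) => p hp; rewrite /y.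
      have [p1|p1] := leP (p - i) h; last by exfalso; nra.
      have [p2|p2] := leP (- h) (p - i); last by exfalso; nra.
      by apply/andP; split; lra.
    apply: le_trans hh.
    apply: marg_near_uniform => //; first exact: tame_del.
      exact: deep_del evu dv.
    exact: degree_del te evu.
  by rewrite -!prodr_const; apply/andP; split; apply: ler_prod => u evu;
    have /andP[h2 h3] := near u evu; apply/andP; split; lra.
have sumE : #|colourings e|%:R * #|C|%:R = \sum_(c : C) \sum_(t in colourings (del e v))
   #|[set x in ext (del e v) A t | avoiding e v c x]|%:R
       / #|ext (del e v) A t|%:R :> R.
  rewrite -natrM (card_colourings_del v es ei) natr_sum.
  by apply: eq_bigr => c _; exact: card_colourings_boundary.
rewrite -[X in X && _](ler_pM2r q0) -[X in _ && X](ler_pM2r q0) sumE.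
have cE (z : R) : z * #|colourings (del e v)|%:R * #|C|%:R
    = \sum_(c : C) \sum_(t in colourings (del e v)) z.
  by rewrite !sumr_const -[RHS]mulr_natr -[z *+ _]mulr_natr.
rewrite !cE; apply/andP; split; apply: ler_sum => c _; apply: ler_sum => t;
  by rewrite inE => /(prob _ c)/andP[].
Qed.

Lemma ln_ratio_le (a b z h : R) (d : nat) : 0 < a -> 0 < b -> 1 / 2 <= z ->
    0 <= h -> h <= 1 / 4 -> (d <= m)%N ->
    (z - h) ^+ d * b <= a <= (z + h) ^+ d * b ->
  `|ln a - ln b - d%:R * ln z| <= 4 * m%:R * h.
Proof.
move=> a0 b0 z2 h0 h4 dm /andP[lo hi].
have z0 : 0 < z by lra.
have zh0 : 0 < z - h by lra.
have lnmul (x : R) : 0 < x -> ln (x ^+ d * b) = d%:R * ln x + ln b.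
  by move=> x0; rewrite lnM ?posrE ?exprn_gt0// lnXn// mulr_natl.
have {}lo : d%:R * ln (z - h) + ln b <= ln a.
  by rewrite -lnmul// ler_ln ?posrE// mulr_gt0// exprn_gt0.
have {}hi : ln a <= d%:R * ln (z + h) + ln b.
  by rewrite -lnmul ?ler_ln ?posrE//; [rewrite mulr_gt0// exprn_gt0//; lra|lra].
pose w := h / z.
have wz : w * z = h by rewrite divfK// gt_eqF.
have w0 : 0 <= w by rewrite divr_ge0// ltW.
have w2 : w <= 2 * h by nra.
(* As z >= 1/2, the relative error w is at most 2 h. *)
have lnp : ln (z + h) <= ln z + 4 * h.
  have -> : z + h = z * (1 + w) by lra.
  rewrite lnM ?posrE//; last lra.
  have : ln (1 + w) <= w by apply: le_ln1Dx; lra.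
  lra.
have lnm : ln z - 4 * h <= ln (z - h).
  have -> : z - h = z * (1 - w) by lra.
  rewrite lnM ?posrE//; last lra.
  have w1 : w < 1 by lra.
  have := oppr_ln_1sub_le R w w0 w1.
  have : (2 - w) / (2 * (1 - w)) <= 2.
    by rewrite ler_pdivrMr; lra.
  set g := _ / _; nra.
have dM : d%:R * h <= m%:R * h by rewrite ler_wpM2r// ler_nat.
have d0 : 0 <= d%:R :> R by [].
rewrite ler_norml; apply/andP; split.
  have : d%:R * (ln z - 4 * h) <= d%:R * ln (z - h) by rewrite ler_wpM2l.
  lra.
have : d%:R * ln (z + h) <= d%:R * (ln z + 4 * h) by rewrite ler_wpM2l.
lra.
Qed.

End Ratio.

(** * Telescoping over the deletions *)

Lemma exists_avoiding (T C : finType) (e : rel T) (v : T) (x : {ffun T -> C}) :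
  (#|e v| < #|C|)%N -> exists b, avoiding e v b x.
Proof.
move=> dv; apply/existsP; apply: contraTT dv => /existsPn no.
rewrite -leqNgt -cardsT; apply: leq_trans (leq_imset_card x (e v)).
apply: subset_leq_card; apply/fintype.subsetP => b _.
have := no b; rewrite negb_forall => /existsP[u].
rewrite negb_imply negbK => /andP[evu /eqP <-].
by apply/imsetP; exists u.
Qed.

Section Telescope.
Set Implicit Arguments.
Unset Strict Implicit.
Variables (R : realType) (m n : nat) (G : sgraph n).
Hypothesis m0 : (0 < m)%N.
Hypothesis degG : (maxdeg G <= m)%N.

(** The graph G_k, with the deleted nodes kept as isolated nodes.  Each of them
contributes a factor q to the number of colourings; this accounts for the factor
q in each term of the sum. *)
Definition edge_from k : rel 'I_n := fun u w => [&& (k <= u)%N, (k <= w)%N & G u w].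

Let cols k := colourings 'I_m.+1 (edge_from k).

Lemma edge_from_sym k : symmetric (edge_from k).
Proof. by move=> u w; rewrite /edge_from adj_sym andbCA. Qed.

Lemma edge_from_irr k : irreflexive (edge_from k).
Proof. by move=> u; rewrite /edge_from adj_irr !andbF. Qed.

Lemma edge_from_degree k u : (#|edge_from k u| <= m)%N.
Proof.
apply: leq_trans degG; apply: leq_trans (leq_bigmax u).
apply: subset_leq_card; apply/fintype.subsetP => w.
by rewrite !unfold_in => /and3P[_ _ ->].
Qed.

Lemma del_edge_from (k : 'I_n) : del (edge_from k) k = edge_from k.+1.
Proof.
apply/funext => u; apply/funext => w; rewrite /del /edge_from.
by rewrite -!val_eqE /= !ltn_neqAle ![_ == val k]eq_sym; do !case: (_ != _); rewrite ?andbF.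
Qed.

Lemma edge_from_deg_in (k : 'I_n) :
  #|edge_from k k| = deg_in G (after_deletion k) k.
Proof.
by apply: eq_card => u; rewrite !unfold_in /edge_from leqnn.
Qed.

Lemma card_cols0 : #|cols 0| = Z m.+1 G.
Proof.
rewrite /Z; apply: eq_card => x; rewrite inE unfold_in /=.
by apply: eq_forallb => u; apply: eq_forallb => v.
Qed.

Lemma card_cols_end : #|cols n| = (m.+1 ^ n)%N.
Proof.
rewrite -[in RHS](card_ord m.+1) -[X in (_ ^ X)%N]card_ord -card_ffun.
apply: eq_card => x; rewrite !inE; apply/respectsP => u w /and3P[h _ _].
by move: (ltn_ord u); rewrite ltnNge h.
Qed.

Lemma cols_gt0 k : (k <= n)%N -> (0 < #|cols k|)%N.
Proof.
move=> kn; rewrite -(subKn kn); elim: (n - k)%N (leq_subr k n) => [|j IH] jn.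
  by rewrite subn0 card_cols_end expn_gt0.
have /card_gt0P[x] := IH (ltnW jn); rewrite inE => hx.
have kj : (n - j.+1 < n)%N by lia.
pose v := Ordinal kj.
have e1 : (n - j)%N = (n - j.+1).+1 by lia.
move: hx; rewrite e1 -[(n - j.+1)%N]/(val v) -del_edge_from => hx.
have [|b hb] := @exists_avoiding _ 'I_m.+1 (edge_from v) v x.
  by rewrite card_ord ltnS edge_from_degree.
apply/card_gt0P; exists (recolour x v b); rewrite inE.
by apply: recolour_respects => //; [exact: edge_from_sym|exact: edge_from_irr].
Qed.

Lemma Z_gt0 : (0 < Z m.+1 G)%N.
Proof. by rewrite -card_cols0 cols_gt0. Qed.

Lemma density_error_le k (h : R) : (0 < n)%N ->
    girth_gt G (k.+3).*2.+1 ->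
    0 <= h -> h <= 1 / 4 -> contraction_rate R m ^+ k * (8 * m.+1%:R ^+ 2) <= h ^+ 2 ->
  `|log_density R m.+1 G - sum_density R m.+1 G| <= 4 * m%:R * h.
Proof.
move=> n0 gt h0 h4 hh.
have nR0 : 0 < n%:R :> R by rewrite ltr0n.
set z : R := 1 - m.+1%:R^-1.
have q0 : 0 < m.+1%:R :> R by rewrite ltr0n.
have z2 : 1 / 2 <= z.
  have : m.+1%:R^-1 <= 2^-1 :> R by rewrite lef_pV2 ?posrE// ler_nat.
  by rewrite /z; set i := _^-1; lra.
pose f k := ln (#|cols k|%:R : R).
pose d (k : 'I_n) := deg_in G (after_deletion k) k.
have step (i : 'I_n) : `|f i - f i.+1 - (d i)%:R * ln z| <= 4 * m%:R * h.
  have c0 : 0 < #|cols i|%:R :> R by rewrite ltr0n cols_gt0// ltnW.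
  have c1 : 0 < #|cols i.+1|%:R :> R by rewrite ltr0n cols_gt0.
  apply: (@ln_ratio_le R m) => //.
    by rewrite /d -edge_from_deg_in edge_from_degree.
  rewrite /d -edge_from_deg_in /cols -del_edge_from.
  apply: (@colouring_ratio_bounds R 'I_n 'I_m.+1 m _ (edge_from i) i k) => //.
  - by rewrite card_ord.
  - exact: edge_from_sym.
  - exact: edge_from_irr.
  - by move=> u; exact: edge_from_degree.
  - by apply: girth_gt_sub gt => u w /and3P[].
  - by rewrite -/z; lra.
have tele : \sum_(i < n) (f i - f i.+1) = ln (Z m.+1 G)%:R - n%:R * ln m.+1%:R.
  rewrite -(big_mkord xpredT (fun i => f i - f i.+1)).
  under eq_bigr do rewrite -opprB.
  rewrite sumrN telescope_sumr// opprB /f card_cols0 card_cols_end.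
  by rewrite natrX lnXn// mulr_natl.
have sumE : sum_density R m.+1 G = n%:R^-1 * (n%:R * ln m.+1%:R + \sum_(i < n) (d i)%:R * ln z).
  rewrite /sum_density; congr (_ * _).
  have -> : n%:R * ln m.+1%:R = \sum_(i < n) ln m.+1%:R :> R.
    by rewrite sumr_const card_ord mulr_natl.
  rewrite -big_split/=.
  apply: eq_bigr => i _; rewrite -/z lnM ?posrE ?exprn_gt0//; last lra.
  by rewrite lnXn ?mulr_natl//; lra.
rewrite /log_density sumE mulrC -mulrBr normrM gtr0_norm ?invr_gt0//.
rewrite mulrC ler_pdivrMr//.
have -> : ln (Z m.+1 G)%:R - (n%:R * ln m.+1%:R + \sum_(i < n) (d i)%:R * ln z)
    = \sum_(i < n) (f i - f i.+1 - (d i)%:R * ln z).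
  by rewrite sumrB tele; lra.
apply: (le_trans (ler_norm_sum _ _ _)).
apply: (le_trans (ler_sum _ (fun i _ => step i))).
by rewrite sumr_const card_ord [leRHS]mulr_natr.
Qed.

Lemma girth_gtP (g l : nat) : (l < g)%N -> (g%:R%:E <= girth R G)%E -> girth_gt G l.
Proof.
move=> lg gG c c2 cyc; apply: leq_trans lg _.
rewrite -(ler_nat R) -lee_fin; apply: le_trans gG _.
by apply: ereal_inf_lbound; exists c => //=; rewrite /is_cycle c2.
Qed.

End Telescope.

(** * The limit over the girth *)
Section Limit.
Set Implicit Arguments.
Unset Strict Implicit.
Variables (R : realType) (m : nat).
Hypothesis m0 : (0 < m)%N.

Lemma geometric_small (l c d : R) : 0 <= l < 1 -> 0 <= c -> 0 < d ->
  exists k, l ^+ k * c <= d.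
Proof.
move=> /andP[l0 l1] c0 d0.
have c1 : 0 < c + 1 by lra.
have /cvgrPdist_le/(_ (d / (c + 1))) : l ^+ n @[n --> \oo] --> (0 : R).
  by apply: cvg_expr; rewrite ger0_norm.
case; first by rewrite divr_gt0.
move=> k _ /(_ k (leqnn k)); rewrite sub0r normrN ger0_norm ?exprn_ge0// => h.
exists k; apply: (@le_trans _ _ (l ^+ k * (c + 1))).
  by rewrite ler_wpM2l ?exprn_ge0//; lra.
by rewrite -ler_pdivlMr.
Qed.

Lemma density_error_small (eps : R) : 0 < eps -> exists g : nat,
  forall n (G : sgraph n), (0 < n)%N -> (maxdeg G <= m)%N ->
    (g%:R%:E <= girth R G)%E ->
  `|log_density R m.+1 G - sum_density R m.+1 G| <= eps.
Proof.
move=> e0; have mR : 0 < m%:R :> R by rewrite ltr0n.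
pose h := Num.min (eps / (4 * m%:R)) (1 / 4).
have h0 : 0 < h by rewrite lt_min divr_gt0//=; lra.
have h4 : h <= 1 / 4 by rewrite ge_min lexx orbT.
have he : 4 * m%:R * h <= eps.
  have : h <= eps / (4 * m%:R) by rewrite ge_min lexx.
  rewrite ler_pdivlMr; lra.
have [k hk] := @geometric_small (contraction_rate R m) (8 * m.+1%:R ^+ 2) (h ^+ 2)
  (contraction_rate_bounds R m m0) (mulr_ge0 (ler0n R 8) (sqr_ge0 _)) (exprn_gt0 2 h0).
exists (k.+3.*2.+2) => n G n0 dG gG.
apply: le_trans he; apply: (density_error_le m0 dG n0 (k := k)) => //.
  exact: girth_gtP gG.
exact: ltW.
Qed.

End Limit.

Lemma sup_density_error_cvg (R : realType) (r q : nat) (hr : (1 <= r)%N)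
    (hq : (r + 1 <= q)%N) :
  ereal_sup [set x : \bar R | exists n (G : sgraph n),
      [/\ (1 <= n)%N, graphs_G0 R n g r G
        & x = `|log_density R q G - sum_density R q G|%:E]]
    @[g --> \oo] --> 0%E.
Proof.
case: q hq => [|m] hq; first by rewrite addn1 in hq.
have rm : (r <= m)%N by rewrite addn1 ltnS in hq.
have m0 : (0 < m)%N := leq_trans hr rm.
pose S (g : nat) := [set x : \bar R | exists n (G : sgraph n),
  [/\ (1 <= n)%N, graphs_G0 R n g r G
    & x = `|log_density R m.+1 G - sum_density R m.+1 G|%:E]].
rewrite -[X in X @ _ --> _]/(fun g => ereal_sup (S g)).
have S_ge g : (0 <= ereal_sup (S g))%E.
  pose G1 : sgraph 1 := @SGraph 1 (fun _ _ => false) (fun _ _ => erefl) (fun _ => erefl).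
  apply: (@le_trans _ _ (`|log_density R m.+1 G1 - sum_density R m.+1 G1|%:E)).
    by rewrite lee_fin.
  apply: ereal_sup_ubound; exists 1%N, G1; split=> //; split.
    apply/bigmax_leqP => v _; rewrite /deg_in eq_card0//.
  rewrite /girth; apply: le_ereal_inf_tmp => _ [c /andP[c2 cyc] <-].
  by move: cyc c2; case: c => // a [//|b c] /andP[/=].
have S_le (e : R) : 0 < e -> exists g0, forall g, (g0 <= g)%N -> (ereal_sup (S g) <= e%:E)%E.
  move=> e0; have [g0 hg0] := density_error_small m0 e0.
  exists g0 => g gg; apply: ge_ereal_sup => _ [n [G [n0 [dG gG] ->]]].
  rewrite lee_fin; apply: hg0 => //; first exact: leq_trans dG rm.
  by apply: le_trans gG; rewrite lee_fin ler_nat.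
apply/fine_cvgP; split.
  have [g0 hg0] := S_le 1 ltr01.
  exists g0 => // g /= gg; rewrite fin_real//.
  rewrite (lt_le_trans _ (S_ge g)) ?ltNyr//= (le_lt_trans (hg0 g gg))//.
  exact: ltry.
apply/cvgrPdist_le => e e0; have [g0 hg0] := S_le e e0.
exists g0 => // g /= gg; rewrite sub0r normrN ger0_norm ?fine_ge0//.
rewrite -lee_fin fineK ?hg0// fin_real//.
rewrite (lt_le_trans _ (S_ge g)) ?ltNyr//= (le_lt_trans (hg0 g gg))//.
exact: ltry.
Qed.

(** * Machine programs *)
Section Machine.
Set Implicit Arguments.
Unset Strict Implicit.
Implicit Types (p : seq instr) (s : store).

(** Exact number of steps, in front of any continuation: in this form runs compose
without bookkeeping. *)
Definition runs t p s s' :=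
  forall rest, iter t step (p ++ rest, s) = (rest, s').

Lemma runs_halts t t' p s s' : runs t p s s' -> (t <= t')%N -> halts_within t' p s s'.
Proof.
move=> /(_ [::]); rewrite cats0 => h tt'; rewrite /halts_within -(subnK tt') iterD h.
by elim: (t' - t)%N => //= k ->.
Qed.

Lemma runs_cat t1 t2 p1 p2 s1 s2 s3 :
  runs t1 p1 s1 s2 -> runs t2 p2 s2 s3 -> runs (t1 + t2) (p1 ++ p2) s1 s3.
Proof. by move=> h1 h2 rest; rewrite addnC iterD -catA h1 h2. Qed.

Lemma runs_cons t i p s1 s2 s3 :
  runs 1 [:: i] s1 s2 -> runs t p s2 s3 -> runs t.+1 (i :: p) s1 s3.
Proof. exact: runs_cat. Qed.

Lemma runs_if t x p1 p2 s s' :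
  runs t (if reg s x != 0%N then p1 else p2) s s' -> runs t.+1 [:: IIf x p1 p2] s s'.
Proof. by move=> h rest; rewrite iterSr /= h. Qed.

Lemma runs_while_stop x p s : reg s x = 0%N -> runs 1 [:: IWhile x p] s s.
Proof. by move=> h rest; rewrite /= h. Qed.

Lemma runs_while_next t1 t2 x p s1 s2 s3 : reg s1 x != 0%N ->
  runs t1 p s1 s2 -> runs t2 [:: IWhile x p] s2 s3 ->
  runs (t1 + t2).+1 [:: IWhile x p] s1 s3.
Proof. by move=> h h1 h2 rest; rewrite iterSr /= h addnC iterD h1 h2. Qed.

(** Registers: 2 holds the constant 1, 3 and 4 count the remaining rows and cells, 5
is the address, 6 the entry read, 7 and 8 collect the positive and the negative
part of the numerator, 1 collects the denominator, 9 to 11 hold the constants of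
[linear_program], and 12 stays 0 so that addition copies registers. *)
Definition scan_cell :=
  [:: ILoad 6 5; IIf 6 [:: IAdd 8 8 10] [::]; IAdd 5 5 2; ISub 4 4 2].

Definition scan_row :=
  [:: IAdd 4 0 12; IWhile 4 scan_cell; IAdd 7 7 9; IAdd 1 1 11; ISub 3 3 2].

Definition linear_program A b D :=
  [:: IConst 2 1; IConst 9 A; IConst 10 b; IConst 11 D; IAdd 3 0 12;
      IWhile 3 scan_row; ISub 0 7 8].

Definition count_cells (s : store) k :=
  (\sum_(i < k) (Defs.mem s (reg s 5 + i) != 0))%N.

Lemma scan_cell_runs j s : reg s 2 = 1%N -> reg s 4 = j ->
  exists t s', [/\ (t <= 6 * j + 1)%N, runs t [:: IWhile 4 scan_cell] s s',
    Defs.mem s' = Defs.mem s, reg s' 5 = (reg s 5 + j)%N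
    & reg s' 8 = (reg s 8 + reg s 10 * count_cells s j)%N /\
      forall x, x \notin [:: 4; 5; 6; 8]%N -> reg s' x = reg s x].
Proof.
elim: j s => [|j IH] s r2 r4.
  exists 1%N, s; split=> //; first exact: runs_while_stop.
    by rewrite addn0.
  by rewrite /count_cells big_ord0 muln0 addn0.
pose c := Defs.mem s (reg s 5).
pose s1 := set_reg s 6 c.
pose s2 := if c != 0%N then set_reg s1 8 (reg s 8 + reg s 10)%N else s1.
pose s3 := set_reg s2 5 (reg s 5 + 1)%N.
pose s4 := set_reg s3 4 j.
have run : exists2 t, (t <= 5)%N & runs t scan_cell s s4.
  exists (if c != 0 then 5 else 4)%N; first by case: ifP.
  move=> rest; rewrite /s4 /s3 /s2; case: ifP => c0.
    by rewrite /= -/c c0 /= /s1 /upd /= r2 r4 subn1.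
  by rewrite /= -/c c0 /= /s1 /upd /= r2 r4 subn1.
have [t t5 {}run] := run.
have m4 : Defs.mem s4 = Defs.mem s by rewrite /s4 /s3 /s2 /s1; case: ifP.
have r45 : reg s4 5 = (reg s 5 + 1)%N by [].
have r48 : reg s4 8 = (reg s 8 + reg s 10 * (c != 0))%N.
  by rewrite /s4 /s3 /s2 /s1; case: ifP => _; rewrite /= ?muln1 ?muln0 ?addn0.
have r4x x : x \notin [:: 4; 5; 6; 8]%N -> reg s4 x = reg s x.
  rewrite !inE !negb_or => /and4P[/negPf h4 /negPf h5 /negPf h6 /negPf h8].
  by rewrite /s4 /s3 /s2 /s1; case: ifP => _; rewrite /= /upd h4 h5 h6 ?h8.
have [|//|t' [s' [t't run' m' r5' [r8' rx']]]] := IH s4; first by rewrite r4x.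
exists (t + t').+1, s'; split.
- lia.
- by apply: runs_while_next run run'; rewrite r4.
- by rewrite m' m4.
- by rewrite r5' r45; lia.
split; last by move=> x hx; rewrite rx'// r4x.
rewrite r8' r48 (r4x 10)// /count_cells big_ord_recl addn0 -/c mulnDr addnA.
congr (_ + _ * _)%N; apply: eq_bigr => i _.
by rewrite m4 r45 /= /bump add1n addn1 addSnnS.
Qed.

Lemma scan_row_runs n i s : reg s 0 = n -> reg s 2 = 1%N -> reg s 12 = 0%N ->
    reg s 3 = i ->
  exists t s', [/\ (t <= (6 * n + 7) * i + 1)%N, runs t [:: IWhile 3 scan_row] s s',
    reg s' 7 = (reg s 7 + reg s 9 * i)%N, reg s' 1 = (reg s 1 + reg s 11 * i)%N
    & reg s' 8 = (reg s 8 + reg s 10 * count_cells s (i * n))%N].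
Proof.
elim: i s => [|i IH] s r0 r2 r12 r3.
  exists 1%N, s; rewrite !muln0 !addn0; split=> //; first exact: runs_while_stop.
  by rewrite /count_cells big_ord0 muln0 addn0.
pose s1 := set_reg s 4 n.
have [||t [s2 [tn run m2 r5 [r8 rx]]]] := @scan_cell_runs n s1 => //.
pose s3 := set_reg s2 7 (reg s2 7 + reg s2 9)%N.
pose s4 := set_reg s3 1 (reg s2 1 + reg s2 11)%N.
pose s5 := set_reg s4 3 i.
have r2x x : x \notin [:: 4; 5; 6; 8]%N -> reg s2 x = reg s x.
  move=> hx; rewrite rx// /s1 /= /upd.
  by case: eqP hx => // ->.
have runrow : runs (t + 3).+1 scan_row s s5.
  apply: (@runs_cons _ _ _ _ s1); first by move=> rest; rewrite /= r0 r12 addn0.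
  apply: (@runs_cat _ 3 [:: IWhile 4 scan_cell] _ _ _ _ run) => rest.
  by rewrite /= /upd/= !r2x// r3 r2 subn1 /s5 /s4 /s3 /= !r2x.
have [||||t' [s' [t't run' r7' r1' r8']]] := IH s5.
- by rewrite /s5 /= /upd/= r2x.
- by rewrite /s5 /= /upd/= r2x.
- by rewrite /s5 /= /upd/= r2x.
- by [].
exists ((t + 3).+1 + t').+1, s'; split.
- nia.
- by apply: runs_while_next runrow run'; rewrite r3.
- by rewrite r7' /= /upd /= !r2x// mulnS addnA.
- by rewrite r1' /= /upd /= !r2x// mulnS addnA.
rewrite r8' /= /upd /= r8 (r2x 10)//= /upd /= /count_cells mulSn big_split_ord/=.
rewrite mulnDr addnA; congr (_ + _ * _)%N; apply: eq_bigr => a _.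
by rewrite m2 {1}/upd /= {1}/upd /= {1}/upd /= r5 /= addnA.
Qed.

Definition cell_total (s : store) k := (\sum_(i < k) (Defs.mem s i != 0%N))%N.

Lemma linear_program_runs A b D n s :
    (forall x, x \notin [:: 0; 13; 14]%N -> reg s x = 0%N) -> reg s 0 = n ->
  exists t s', [/\ (t <= (6 * n + 7) * n + 7)%N, runs t (linear_program A b D) s s',
    reg s' 0 = (A * n - b * cell_total s (n * n))%N & reg s' 1 = (D * n)%N].
Proof.
move=> rs r0.
pose s1 := set_reg s 2 1. pose s2 := set_reg s1 9 A. pose s3 := set_reg s2 10 b.
pose s4 := set_reg s3 11 D. pose s5 := set_reg s4 3 n.
have [||||t [s' [tn run r7 r1 r8]]] := @scan_row_runs n n s5 => //.
  by rewrite /= /upd /= rs.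
pose s6 := set_reg s' 0 (reg s' 7 - reg s' 8)%N.
exists (5 + (t + 1))%N, s6; split; first lia.
- apply: (@runs_cat 5 _ [:: IConst 2 1; IConst 9 A; IConst 10 b; IConst 11 D; IAdd 3 0 12] _ s s5).
    by move=> rest; rewrite /= /upd /= r0 rs// addn0.
  by apply: (@runs_cat _ 1 [:: _] _ _ _ _ run).
- rewrite /s6 /= /upd /= r7 r8 /= /upd /= !rs// !add0n /count_cells /cell_total /=.
  by rewrite /upd /= rs.
by rewrite /s6 /= /upd /= r1 /= /upd /= rs.
Qed.

(** Decision tree on the N cells from address k on, with leaves given by h. *)
Fixpoint tabulate (N k : nat) (h : seq bool -> nat * nat) : seq instr :=
  if N is N'.+1 then
    [:: IConst 2 k; ILoad 3 2;
        IIf 3 (tabulate N' k.+1 (fun l => h (true :: l)))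
              (tabulate N' k.+1 (fun l => h (false :: l)))]
  else [:: IConst 0 (h [::]).1; IConst 1 (h [::]).2].

Lemma tabulate_runs N k h s : exists s',
  let l := [seq Defs.mem s a != 0%N | a <- iota k N] in
  [/\ runs (3 * N + 2) (tabulate N k h) s s', reg s' 0 = (h l).1 & reg s' 1 = (h l).2].
Proof.
elim: N k h s => [|N IH] k h s.
  by exists (set_reg (set_reg s 0 (h [::]).1) 1 (h [::]).2).
pose s1 := set_reg s 2 k; pose s2 := set_reg s1 3 (Defs.mem s k).
have [s' [run r0 r1]] := IH k.+1 (fun l => h ((Defs.mem s k != 0%N) :: l)) s2.
exists s'; split; [|exact: r0|exact: r1].
rewrite mulnS -addnA; apply: (@runs_cons _ _ _ _ s1) => //.
apply: (@runs_cons _ _ _ _ s2) => //; apply: runs_if.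
by rewrite /= /upd /=; case: (_ != _) run.
Qed.

(** Compares n with j, j + 1, ..., j + k - 1 in turn.  Only the registers 13 and 14
are touched, so the selected program starts on an intact input. *)
Fixpoint dispatch (k j : nat) (small : nat -> seq instr) (large : seq instr) :=
  if k is k'.+1 then
    [:: IConst 13 j; ISub 14 0 13; IIf 14 (dispatch k' j.+1 small large) (small j)]
  else large.

Lemma dispatch_runs k j small large s : (j <= reg s 0)%N -> exists s1,
  [/\ Defs.mem s1 = Defs.mem s,
      forall x, x \notin [:: 13; 14]%N -> reg s1 x = reg s x &
      forall t s', runs t (if (reg s 0 < j + k)%N then small (reg s 0) else large) s1 s' ->
      exists2 t', (t' <= 3 * k + t)%N & runs t' (dispatch k j small large) s s'].
Proof.
elim: k j s => [|k IH] j s js.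
  by exists s; split=> // t s'; rewrite addn0 ltnNge js /= => run; exists t.
pose s1 := set_reg s 13 j; pose s2 := set_reg s1 14 (reg s 0 - j)%N.
have r2x x : x \notin [:: 13; 14]%N -> reg s2 x = reg s x.
  by rewrite !inE negb_or => /andP[/negPf h13 /negPf h14]; rewrite /= /upd h14 h13.
have start t s' : runs t (if (reg s 0 - j != 0)%N then dispatch k j.+1 small large
    else small j) s2 s' -> runs t.+3 (dispatch k.+1 j small large) s s'.
  move=> run; apply: (@runs_cons _ _ _ _ s1) => //.
  by apply: (@runs_cons _ _ _ _ s2) => //; exact: runs_if.
have [jr|rj] := ltnP j (reg s 0).
  have [|s3 [m3 r3 h3]] := IH j.+1 s2; first by rewrite r2x.
  exists s3; split.
  - by rewrite m3.
  - by move=> x hx; rewrite r3// r2x.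
  move=> t s' run; have [|t' t't run'] := h3 t s'.
    by rewrite r2x// addSnnS.
  exists t'.+3; first lia.
  by apply: start; rewrite subn_eq0 leqNgt jr.
have rE : reg s 0 = j by apply/eqP; rewrite eqn_leq rj.
exists s2; split=> // t s'; rewrite rE -{1}[j]addn0 ltn_add2l /= => run.
by exists t.+3; [lia|apply: start; rewrite rE subnn].
Qed.

End Machine.

(** * Reading the graph from the input *)
Section InputDecoding.
Set Implicit Arguments.
Unset Strict Implicit.
Variables (n : nat) (G : sgraph n).

Lemma cell_index_inj (u v u' v' : 'I_n) :
  (u * n + v)%N = (u' * n + v')%N -> u = u' /\ v = v'.
Proof.
move=> h; have n0 : (0 < n)%N := leq_ltn_trans (leq0n u) (ltn_ord u).
split; apply: val_inj => /=.
  by have := congr1 (divn^~ n) h; rewrite !divnMDl// !divn_small// !addn0.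
by have := congr1 (modn^~ n) h; rewrite !modnMDl !modn_small.
Qed.

Lemma mem_input (u v : 'I_n) : Defs.mem (input G) (u * n + v)%N = G u v.
Proof.
rewrite /=; congr nat_of_bool; apply/existsP/idP => [[u' /existsP[v']]|guv].
  by move=> /andP[/eqP/cell_index_inj[-> ->]].
by exists u; apply/existsP; exists v; rewrite eqxx.
Qed.

Lemma cell_lt (u v : 'I_n) : (u * n + v < n * n)%N.
Proof.
apply: (@leq_trans (u.+1 * n)); first by rewrite mulSn addnC ltn_add2r.
by rewrite leq_mul2r ltn_ord orbT.
Qed.

(** Division of the addresses by the row length. *)
Lemma sum_grid (k l : nat) (F : nat -> nat) :
  (\sum_(i < k * l) F i = \sum_(u < k) \sum_(v < l) F (u * l + v))%N.
Proof.
elim: k F => [|k IH] F; first by rewrite !big_ord0.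
rewrite mulSn big_split_ord/= big_ord_recl/= (IH (fun i => F (l + i)%N)).
by congr (_ + _)%N; apply: eq_bigr => u _; apply: eq_bigr => v _; rewrite /bump add1n mulSn addnA.
Qed.

(** Each edge gives two ones in the matrix, and it is counted by the smaller of its
ends in the sum over k. *)
Lemma cell_total_input :
  cell_total (input G) (n * n) = (2 * \sum_(k < n) deg_in G (after_deletion k) k)%N.
Proof.
rewrite /cell_total (sum_grid _ _ (fun a => Defs.mem (input G) a != 0%N)).
under eq_bigr do under eq_bigr do rewrite mem_input.
have degE (k : 'I_n) : deg_in G (after_deletion k) k = (\sum_(u < n) ((k <= u)%N && G k u))%N.
  by rewrite /deg_in -sum1_card big_mkcond/=; apply: eq_bigr => u _; rewrite unfold_in; case: (_ && _).
under [in RHS]eq_bigr do rewrite degE.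
rewrite mul2n -addnn [X in (_ + X)%N]exchange_big/= -big_split/=.
apply: eq_bigr => u _; rewrite -big_split/=; apply: eq_bigr => v _.
rewrite (adj_sym G v u).
have [->|uv] := eqVneq u v; first by rewrite adj_irr !andbF.
by case: (G u v); rewrite ?andbF// !andbT; case: (ltngtP u v) uv => // /val_inj ->; rewrite eqxx.
Qed.

Definition rel_of_cells (l : seq bool) : rel 'I_n := fun u v => nth false l (u * n + v).

Lemma rel_of_cells_input :
  rel_of_cells [seq Defs.mem (input G) a != 0%N | a <- iota 0 (n * n)] = G.
Proof.
apply/funext => u; apply/funext => v; rewrite /rel_of_cells.
rewrite (nth_map 0%N) ?size_iota ?cell_lt// nth_iota ?cell_lt// add0n mem_input.
by case: (G u v).
Qed.

Lemma Z_rel_of_cells q : Z q G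
  = #|colourings 'I_q (rel_of_cells [seq Defs.mem (input G) a != 0%N | a <- iota 0 (n * n)])|.
Proof.
rewrite rel_of_cells_input /Z; apply/esym/eq_card => x; rewrite inE unfold_in /=.
by apply: eq_forallb => u; apply: eq_forallb => v.
Qed.

Lemma sum_deg_le m : (maxdeg G <= m)%N ->
  (2 * \sum_(k < n) deg_in G (after_deletion k) k <= n * m)%N.
Proof.
move=> dG; rewrite -cell_total_input /cell_total (sum_grid _ _ (fun a => Defs.mem (input G) a != 0%N)).
rewrite -[X in (_ <= X * _)%N](card_ord n) -sum_nat_const leq_sum// => u _.
apply: leq_trans dG; apply: leq_trans (leq_bigmax u).
rewrite /deg_in -sum1_card [leqRHS]big_mkcond leq_sum// => v _.
by rewrite mem_input unfold_in /=; case: (G u v).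
Qed.

End InputDecoding.

Section Approximation.
Set Implicit Arguments.
Unset Strict Implicit.
Variables (R : realType) (m : nat).
Hypothesis m0 : (0 < m)%N.

Lemma rational_below (d : R) : 0 < d -> exists2 D : nat, (0 < D)%N &
  forall L : R, 0 <= L -> exists a : nat, L - d <= a%:R / D%:R <= L.
Proof.
move=> d0; pose D := (Num.bound d^-1).+1; exists D => // L L0.
have D0 : 0 < D%:R :> R by rewrite ltr0n.
have dD : D%:R^-1 <= d.
  rewrite -[leRHS]invrK lef_pV2 ?posrE ?invr_gt0//.
  apply: ltW; apply: (lt_trans (archi_boundP _)); first by rewrite invr_ge0 ltW.
  by rewrite ltr_nat.
exists (Num.truncn (L * D%:R)).
have LD : 0 <= L * D%:R by rewrite mulr_ge0.
have /andP[h1 h2] := truncn_itv LD.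
rewrite ler_pdivrMr// h1 andbT ler_pdivlMr// mulrBl.
have : 1 <= d * D%:R by rewrite -ler_pdivrMr// mul1r.
by move: h2; rewrite -natr1; lra.
Qed.

(** Exchanging two colours in a colouring gives another one. *)
Lemma Z_ge2 n (G : sgraph n) : (0 < n)%N -> (maxdeg G <= m)%N -> (2 <= Z m.+1 G)%N.
Proof.
move=> n0 dG; have := Z_gt0 m0 dG; case/card_gt0P => x hx.
pose v := Ordinal n0; pose b : 'I_m.+1 := if x v == ord0 then ord_max else ord0.
have bv : b != x v.
  rewrite /b; have [->|xv0] := eqVneq (x v) ord0; last by rewrite eq_sym.
  by rewrite -val_eqE/= -lt0n.
pose y : {ffun 'I_n -> 'I_m.+1} := [ffun u => tperm (x v) b (x u)].
have xy : x != y.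
  apply/eqP => /ffunP/(_ v); rewrite ffunE tpermL => /eqP.
  by rewrite eq_sym (negPf bv).
have hy : Defs.proper G y.
  apply/forallP => u; apply/forallP => w; apply/implyP => guw.
  rewrite !ffunE (inj_eq perm_inj).
  by move: hx; rewrite unfold_in => /forallP/(_ u)/forallP/(_ w)/implyP; apply.
have card_xy : #|[set x; y]%SET| = 2%N by rewrite cards2 xy.
rewrite -card_xy /Z.
apply: subset_leq_card; apply/fintype.subsetP => z.
by rewrite !inE => /orP[] /eqP ->.
Qed.

Lemma sum_densityE n (G : sgraph n) : (0 < n)%N ->
  sum_density R m.+1 G = ln m.+1%:R
    - (- ln (1 - m.+1%:R^-1)) * ((\sum_(k < n) deg_in G (after_deletion k) k)%:R / n%:R).
Proof.
move=> n0; have nR : 0 < n%:R :> R by rewrite ltr0n.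
set z : R := 1 - m.+1%:R^-1.
have q0 : 0 < m.+1%:R :> R by rewrite ltr0n.
have z0 : 0 < z by rewrite subr_gt0 invf_lt1// ltr1n ltnS.
rewrite /sum_density natr_sum.
have -> : \sum_(k < n) ln (m.+1%:R * z ^+ deg_in G (after_deletion k) k)
    = n%:R * ln m.+1%:R + \sum_(k < n) (deg_in G (after_deletion k) k)%:R * ln z.
  have -> : n%:R * ln m.+1%:R = \sum_(i < n) ln m.+1%:R :> R.
    by rewrite sumr_const card_ord mulr_natl.
  rewrite -big_split/=; apply: eq_bigr => i _.
  by rewrite lnM ?posrE ?exprn_gt0// lnXn// mulr_natl.
rewrite -mulr_suml mulrDr mulKf ?gt_eqF//; lra.
Qed.

(** The third bound keeps the densities away from 0.  At most n m / 2 edges exist and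
- ln (1 - 1/q) = ln (1 + 1/m) <= 1/m, so at most 1/2 is subtracted from
ln q >= ln 2. *)
Lemma log_pair_bounds : [/\ 0 <= ln (m.+1%:R : R), 0 <= - ln (1 - m.+1%:R^-1 : R)
  & 24 / 35 - 1 / 2 <= ln (m.+1%:R : R) - (- ln (1 - m.+1%:R^-1)) * (m%:R / 2)].
Proof.
have mR : 1 <= m%:R :> R by rewrite ler1n.
have q0 : 0 < m.+1%:R :> R by rewrite ltr0n.
have q1 : m.+1%:R = m%:R + 1 :> R by rewrite natr1.
have i1 : m.+1%:R^-1 * m.+1%:R = 1 :> R by rewrite mulVf// gt_eqF.
set i : R := m.+1%:R^-1 in i1 *.
have i0 : 0 < i by rewrite invr_gt0.
have i2 : i <= 1 / 2 by nra.
split.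
- by apply: ln_ge0; lra.
- by rewrite oppr_ge0; apply: ln_le0; lra.
have l2 : 24 / 35 <= ln (m.+1%:R : R).
  by apply: le_trans (ln2_ge R) _; rewrite ler_ln ?posrE//; lra.
have : - ln (1 - i) * m%:R <= 1.
  have z0 : 0 < 1 - i by lra.
  have zE : (1 - i)^-1 = 1 + m%:R^-1.
    apply: (mulfI (lt0r_neq0 z0)); rewrite divff ?lt0r_neq0//.
    have mm : m%:R * m%:R^-1 = 1 :> R by rewrite divff// gt_eqF//; lra.
    have h1 : i = 1 - i * m%:R by move: i1; rewrite q1; lra.
    have := congr1 (fun t => i * t) mm; move: h1; nra.
  rewrite -lnV ?posrE// zE -ler_pdivlMr ?mul1r; last lra.
  by apply: le_ln1Dx; rewrite (lt_trans (ltrN10 R))// invr_gt0; lra.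
lra.
Qed.

End Approximation.

(** * The approximation scheme *)
Section Scheme.
Set Implicit Arguments.
Unset Strict Implicit.
Variables (R : realType) (m : nat).
Hypothesis m0 : (0 < m)%N.

Definition ratio (x : nat * nat) : R := x.1%:R / x.2%:R.

(** The density depends only on n and on the number of colourings, and the matrix
determines the latter; so it suffices to choose a rational for each pair of
numbers. *)
Lemma small_graph_table (eps : R) : 0 < eps ->
  exists table : nat -> seq bool -> nat * nat,
    forall n (G : sgraph n), (0 < n)%N -> (maxdeg G <= m)%N ->
      eps_approx m.+1 G eps (ratio (table n
        [seq Defs.mem (input G) a != 0%N | a <- iota 0 (n * n)])).
Proof.
move=> e0.
have /choice[f hf] : forall x : nat * nat, exists y : nat * nat,
    (2 <= x.1)%N -> (0 < x.2)%N -> let L := ln x.1%:R / x.2%:R in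
    [/\ 0 < ratio y, (1 - eps) * L <= ratio y & ratio y <= (1 + eps) * L].
  move=> [z n]; have [z2|z2] := leqP 2 z; last by exists (0%N, 0%N).
  have [_|n0] := posnP n; first by exists (0%N, 0%N).
  set L : R := ln z%:R / n%:R.
  have L0 : 0 < L by rewrite divr_gt0 ?ltr0n// ln_gt0// ltr1n.
  have eL : 0 < eps * L by rewrite mulr_gt0.
  have [|D D0 /(_ L (ltW L0))[a /andP[h1 h2]]] :=
      @rational_below R (Num.min (eps * L) (L / 2)).
    by rewrite lt_min eL divr_gt0.
  exists (a, D) => _ _ /=; rewrite /ratio /=.
  have d1 : Num.min (eps * L) (L / 2) <= eps * L by rewrite ge_min lexx.
  have d2 : Num.min (eps * L) (L / 2) <= L / 2 by rewrite ge_min lexx orbT.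
  by rewrite -/L; split; lra.
exists (fun n l => f (#|colourings 'I_m.+1 (rel_of_cells (n := n) l)|, n)).
move=> n G n0 dG; rewrite -Z_rel_of_cells.
by have := hf (Z m.+1 G, n) (Z_ge2 m0 n0 dG) n0.
Qed.

(** Two errors of at most d occur, one from [density_error_small] and one from the
rational approximations; they are small compared with c, a lower bound of
[sum_density].  The truncated subtraction is exact because its value is close to
a density. *)
Lemma large_girth_estimate (eps : R) : 0 < eps ->
  exists A b D g : nat, (0 < D)%N /\
    forall n (G : sgraph n), (0 < n)%N -> (maxdeg G <= m)%N ->
      (g%:R%:E <= girth R G)%E ->
      eps_approx m.+1 G eps
        (ratio ((A * n - b * cell_total (input G) (n * n))%N, (D * n)%N)).
Proof.
move=> e0; pose c : R := 24 / 35 - 1 / 2.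
pose d := Num.min 1 eps * (c / 8).
have c0 : 0 < c by rewrite /c; lra.
have d0 : 0 < d by rewrite mulr_gt0 ?lt_min ?ltr01//; lra.
have d1 : d <= c / 8.
  by rewrite /d ler_piMl ?ge_min ?lexx//; lra.
have d2 : d <= eps * (c / 8).
  by rewrite /d ler_wpM2r ?ge_min ?lexx ?orbT//; lra.
have [La0 Lb0 Lge] := log_pair_bounds R m0.
rewrite -/c in Lge.
set La := ln _ in La0 Lge; set Lb := - ln _ in Lb0 Lge.
have mR1 : 1 <= m%:R :> R by rewrite ler1n.
have dm0 : 0 < d / m%:R by rewrite divr_gt0//; lra.
have [D D0 approx] := rational_below dm0.
have [a /andP[a1 a2]] := approx _ La0.
have [b /andP[b1 b2]] := approx _ Lb0.
have [g hg] := density_error_small m0 d0.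
(* The factors 2 compensate for the matrix showing every edge twice. *)
exists (2 * a)%N, b, (2 * D)%N, g; split; first by rewrite muln_gt0.
move=> n G n0 dG gG; have := hg n G n0 dG gG.
rewrite (sum_densityE R m0 G n0) -/La -/Lb cell_total_input.
have := sum_deg_le dG.
set E := (\sum_(k < n) _)%N => En.
have nR : 0 < n%:R :> R by rewrite ltr0n.
have DR : 0 < D%:R :> R by rewrite ltr0n.
set x : R := E%:R / n%:R.
have x0 : 0 <= x by rewrite divr_ge0// ltW.
have xm : x <= m%:R / 2.
  move: En; rewrite -(ler_nat R) !natrM => En'.
  by rewrite ler_pdivrMr//; lra.
set ld := log_density R m.+1 G => err.
have {err} : - d <= ld - (La - Lb * x) <= d by rewrite -ler_norml.
move=> /andP[e1 e2].
set av := a%:R / D%:R in a1 a2; set bv := b%:R / D%:R in b1 b2.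
have dm1 : d / m%:R <= d by rewrite ler_pdivrMr; nra.
have dmm : d / m%:R * m%:R = d by rewrite divfK// gt_eqF//; lra.
have LbX : Lb * x <= Lb * (m%:R / 2) by rewrite ler_wpM2l.
have bx1 : bv * x <= Lb * x by rewrite ler_wpM2r.
have bx2 : Lb * x - d / 2 <= bv * x.
  have : (Lb - d / m%:R) * x <= bv * x by rewrite ler_wpM2r.
  have : d / m%:R * x <= d / m%:R * (m%:R / 2) by rewrite ler_wpM2l// ltW.
  lra.
have val : ratio ((2 * a * n - b * (2 * E))%N, (2 * D * n)%N) = av - bv * x.
  have le : (b * (2 * E) <= 2 * a * n)%N.
    rewrite -(ler_nat R) !natrM.
    have : bv * x <= av by lra.
    rewrite /av /bv /x mulrACA ler_pdivlMr// -[leLHS]mulrA.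
    have -> : (D%:R^-1 / n%:R * D%:R : R) = n%:R^-1.
      by rewrite mulrAC mulVf ?mul1r// gt_eqF.
    by rewrite ler_pdivrMr//; lra.
  rewrite /ratio /= natrB// !natrM.
  have nn : n%:R * n%:R^-1 = 1 :> R by rewrite divff// gt_eqF.
  have DD : D%:R * D%:R^-1 = 1 :> R by rewrite divff// gt_eqF.
  rewrite /av /bv /x.
  apply: (mulIf (x := 2 * D%:R * n%:R)); first by rewrite !mulf_neq0// gt_eqF.
  rewrite divfK; last by rewrite !mulf_neq0// gt_eqF.
  have := congr1 (fun t => 2 * a%:R * n%:R * t) DD.
  have := congr1 (fun t => 2 * b%:R * E%:R * t) DD.
  have := congr1 (fun t => 2 * b%:R * E%:R * (D%:R * D%:R^-1) * t) nn.
  lra.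
rewrite val; have ldc : c - d <= ld by lra.
have eld : eps * (c - d) <= eps * ld by rewrite ler_wpM2l// ltW.
have ecd : eps * d <= eps * (c / 8) by rewrite ler_wpM2l// ltW.
by rewrite /eps_approx -/ld; split; lra.
Qed.

(** Beyond the size N every member of the family has girth at least g, and the linear
program applies; below N the program consults a table. *)
Lemma has_PAS_of_large_girth (F : forall n, set (sgraph n)) :
  (forall n (G : sgraph n), F n G -> (maxdeg G <= m)%N) ->
  large_girth R F -> has_PAS R m.+1 F.
Proof.
move=> dF [f [_ flim fgirth]] eps e0.
have [table htable] := small_graph_table e0.
have [A [b [D [g [D0 hest]]]]] := large_girth_estimate e0.
have [N _ hN] : \forall s \near \oo, (g <= f s)%N by exact: flim (nbhs_infty_ge g).
pose small n := tabulate (n * n) 0 (table n).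
exists (dispatch N 0 small (linear_program A b D)), (3 * N + 3 * (N * N) + 22)%N, 2%N.
move=> n G n0 FG; have dG := dF _ _ FG.
have [s1 [ms rs hs]] := @dispatch_runs N 0 small (linear_program A b D) (input G) (leq0n _).
have r0 : reg s1 0 = n by rewrite rs.
rewrite /= add0n in hs.
have [nN|Nn] := ltnP n N; last first.
  have [|t [s' [tn run s'0 s'1]]] := @linear_program_runs A b D n s1 _ r0.
    move=> x; rewrite !inE !negb_or => /and3P[/negPf x0 x13 x14].
    by rewrite rs ?inE ?negb_or ?x13// /= x0.
  have [|t' t't run'] := hs t s'; first by rewrite ltnNge Nn.
  exists s'; split; first by apply: runs_halts run' _; nia.
  rewrite /output s'0 s'1.
  have -> : cell_total s1 (n * n) = cell_total (input G) (n * n).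
    by rewrite /cell_total ms.
  apply: hest => //; apply: le_trans (fgirth _ _ FG).
  by rewrite lee_fin ler_nat; exact: hN.
have [s' [run s'0 s'1]] := tabulate_runs (n * n) 0 (table n) s1.
have [|t' t't run'] := hs (3 * (n * n) + 2)%N s'; first by rewrite nN.
exists s'; split; first by apply: runs_halts run' _; nia.
by rewrite /output s'0 s'1 ms; exact: htable.
Qed.

End Scheme.

Theorem theorem2 (R : realType) (r q : nat) (hr : (1 <= r)%N)
    (hq : (r + 1 <= q)%N) :
  ereal_sup [set x : \bar R | exists n (G : sgraph n),
      [/\ (1 <= n)%N, graphs_G0 R n g r G
        & x = `|log_density R q G - sum_density R q G|%:E]]
    @[g --> \oo] --> 0%E
  /\
  (forall F : forall n, set (sgraph n),
     (forall n (G : sgraph n), F n G -> (maxdeg G <= r)%N) ->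
     large_girth R F ->
     has_PAS R q F).
Proof.
split; first exact: sup_density_error_cvg.
case: q hq => [|m] hq F dF; first by rewrite addn1 in hq.
have rm : (r <= m)%N by rewrite addn1 ltnS in hq.
apply: has_PAS_of_large_girth; first exact: leq_trans hr rm.
by move=> n G FG; exact: leq_trans (dF n G FG) rm.
Qed.
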